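(* Let $p$ be a prime with $p \equiv 1 \pmod 3$ and $p \equiv 5 \pmod 8$. Let $G=\mathrm{SL}_3(p) \rtimes \langle t \rangle$, where $t$ is the transpose inverse automorphism $A\mapsto (A^{T})^{-1}$ of $\mathrm{SL}_3(p)$. Then $G$ has an unravelled C-string of rank $4$ with Schläfli symbol $[4,p,4]$.
   Context: $\mathrm{SL}_3(p)$ is the group of $3\times 3$ matrices of determinant $1$ over the finite field $\mathrm{GF}(p)$ with $p$ elements. In the semidirect product, $t$ is an element of order $2$. C-strings. Let $G$ be a group and $\{t_1,\ldots,t_n\}$ a set of involutions (elements of order $2$) in $G$, indexed in the given order by $I=\{1,\ldots,n\}$. For $J\subseteq I$ put $G_J=\langle t_j \mid j\in J\rangle$, with $G_\emptyset=1$. The set $\{t_1,\ldots,t_n\}$ is a C-string for $G$ (of rank $n$) if: (a) $G=\langle t_1,\ldots,t_n\rangle$; (b) $t_i$ and $t_j$ commute whenever $|i-j|\ge 2$; (c) (intersection property) $G_J\cap G_K=G_{J\cap K}$ for all $J,K\subseteq I$. The Schläfli symbol of the C-string is the sequence $[\tau_{12},\tau_{23},\ldots,\tau_{n-1\,n}]$, where $\tau_{j\,j+1}$ is the order of $t_jt_{j+1}$. Unravelled C-strings. Let $G$ be a finite group with a C-string $\{t_1,\ldots,t_n\}$ of rank $n$. For $N\trianglelefteq G$, write $\overline{g}$ for the image of $g$ in $\overline{G}=G/N$. The C-string is called $N$-unravelled if either $|\{\overline{t_1},\ldots,\overline{t_n}\}|<n$, or $|\{\overline{t_1},\ldots,\overline{t_n}\}|=n$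 and $\{\overline{t_1},\ldots,\overline{t_n}\}$ (with the inherited ordering) is not a C-string for $\overline{G}$. It is called unravelled if it is $N$-unravelled for every non-trivial proper normal subgroup $N$ of $G$. *)

(* Defs.v *)
From HB Require Import structures.
From mathcomp Require Import all_boot all_order all_fingroup all_algebra.
From mathcomp Require Import all_solvable.

Set Implicit Arguments.
Unset Strict Implicit.
Unset Printing Implicit Defensive.

Import GRing.Theory.
Local Open Scope group_scope.

Section CString.

Variable gT : finGroupType.

(* The indices run over {0, ..., n-1} instead of {1, ..., n}. *)
Definition sub_gen n (t : n.-tuple gT) (J : {set 'I_n}) : {set gT} :=
  <<[set tnth t j | j in J]>>.

Definition cstring (G : {set gT}) n (t : n.-tuple gT) : Prop :=
  [/\ uniq t /\ (forall i, #[tnth t i] = 2),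
      sub_gen t setT = G,
      (forall i j : 'I_n, i.+1 < j -> commute (tnth t i) (tnth t j))
    & (forall J K : {set 'I_n},
         sub_gen t J :&: sub_gen t K = sub_gen t (J :&: K))].

Definition schlafli (s : seq gT) : seq nat :=
  if s is x :: s' then pairmap (fun y z => #[y * z]) x s' else [::].

End CString.

Section Unravelled.

Variables (gT : finGroupType) (G : {group gT}) (n : nat) (t : n.-tuple gT).

Definition tquo (N : {group gT}) : n.-tuple (coset_of N) :=
  map_tuple (coset N) t.

Definition N_unravelled (N : {group gT}) : Prop :=
  #|[set x in tquo N]| < n
  \/ (#|[set x in tquo N]| = n /\ ~ cstring (G / N) (tquo N)).

Definition unravelled : Prop :=
  forall N : {group gT}, N <| G -> N :!=: 1 -> N \proper G -> N_unravelled N.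

End Unravelled.

Section SpecialLinear.

Variables (n : nat) (F : finFieldType).

Definition SL : {set {'GL_n[F]}} := [set A | (\det (GLval A) == 1)%R].

Lemma SL_group_set : group_set SL.
Proof.
apply/group_setP; split=> [|A B]; first by rewrite inE GL_1E det1.
by rewrite !inE GL_MxE det_mulmx => /eqP-> /eqP->; rewrite mulr1.
Qed.
Canonical SL_group := Group SL_group_set.

Lemma invtr_unit (A : {'GL_n[F]}) :
  invmx (GLval A)^T%R \is a GRing.unit.
Proof. by rewrite -[_ \is a _]/(_ \in unitmx) unitmx_inv unitmx_tr GL_unit. Qed.

Definition invtr (A : {'GL_n[F]}) : {'GL_n[F]} := FinRing.Unit (invtr_unit A).

Lemma invtrM : {in SL &, {morph invtr : A B / A * B}}.
Proof.
move=> A B _ _; apply: val_inj; rewrite /= trmx_mul.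
by rewrite -[LHS]/((_ * _)^-1)%R invrM // -[_ \is a _]/(_ \in unitmx)
  unitmx_tr GL_unit.
Qed.
Canonical invtr_morphism := Morphism invtrM.

Lemma invtrK : involutive invtr.
Proof. by move=> A; apply: val_inj; rewrite /= trmx_inv trmxK invmxK. Qed.

Lemma injm_invtr : 'injm invtr_morphism.
Proof. by apply/injmP; apply: in2W; apply: inv_inj invtrK. Qed.

Lemma im_invtr : invtr_morphism @* SL = SL.
Proof.
apply/morphim_fixP; rewrite ?injm_invtr //.
apply/subsetP=> _ /morphimP[A _ SLA ->].
by move: SLA; rewrite !inE /= det_inv det_tr => /eqP->; rewrite invr1.
Qed.

(* Acts as A |-> (A^T)^-1 on SL, and fixes the elements of GL outside SL. *)
Definition invtr_aut : {perm {'GL_n[F]}} := aut injm_invtr im_invtr.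

Lemma invtr_autE A : A \in SL -> invtr_aut A = invtr A.
Proof. exact: autE. Qed.

Lemma cycle_invtr_sub : <[invtr_aut]> \subset Aut SL.
Proof. by rewrite cycle_subG Aut_aut. Qed.

Definition invtr_action : groupAction <[invtr_aut]> SL :=
  (aut_groupAction SL \ cycle_invtr_sub)%gact.

Definition SL_invtr : finGroupType := sdprod_by invtr_action.

End SpecialLinear.

Lemma order_invtr_aut (F : finFieldType) : #[invtr_aut 3 F] = 2.
Proof.
apply: nt_prime_order => //.
  apply/permP=> A; rewrite expgS expg1 permM perm1.
  have [SLA | nSLA] := boolP (A \in SL 3 F).
    by rewrite !invtr_autE ?invtrK // -im_invtr mem_morphim.
  by rewrite !permE /= (negbTE nSLA) (negbTE nSLA).
pose i0 : 'I_3 := ord0; pose i1 : 'I_3 := lift ord0 ord0.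
pose M : 'M[F]_3 := (1%:M + delta_mx i0 i1)%R.
have detM : (\det M = 1)%R.
  rewrite -det_tr det_trig; last first.
    apply/is_trig_mxP => i j lij; rewrite !mxE -!val_eqE /=.
    by case: (val j) lij => // k ik; rewrite gtn_eqF ?addr0.
  by rewrite big1 // => i _; rewrite !mxE eqxx -!val_eqE /=;
     case: (val i) => [|k]; rewrite addr0.
have uM : M \is a GRing.unit.
  by rewrite -[_ \is a _]/(_ \in unitmx) unitmxE detM unitr1.
pose A : {'GL_3[F]} := FinRing.Unit uM.
have SLA : A \in SL 3 F by rewrite inE /= detM.
apply/eqP=> t1; have := invtr_autE SLA; rewrite t1 perm1.
move/(congr1 val)=> /= eqM.
have : (M *m M^T = 1%:M)%R by rewrite {1}eqM mulVmx // unitmx_tr.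
move/matrixP/(_ i0 i1); rewrite !mxE !big_ord_recl big_ord0 !mxE /=.
by rewrite !(mulr0, mul0r, addr0, add0r, mulr1) => /eqP; rewrite oner_eq0.
Qed.

(* Main.v *)
Require Import Defs.
From mathcomp Require Import all_boot all_order all_fingroup all_algebra.
From mathcomp Require Import all_solvable ring zify.

Set Implicit Arguments.
Unset Strict Implicit.
Unset Printing Implicit Defensive.

Import GRing.Theory.

(** Matrix units e_ij are numbered from 1 in these explanations.  Write N for the
    nilpotent matrix e12 + e23, d for diag(-1, 1, -1), and let
    w be a primitive cube root of unity and im a square root of -1 in GF(p);
    they exist since p = 1 modulo 3 and modulo 4.  An element of G is
    either inn A, with A in SL_3(p), or out A = inn A * tau, where tau is the
    transpose inverse.  The involutions out C are those with C symmetric: they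
    are the polarities of the projective plane.

    The C-string is t0 = out d, t1 = inn (exp(2N) d), t2 = inn d, t3 = t0 ^ kappa,
    where kappa is an inner element which exchanges t1 and t2.  Here t1 * t2 is
    the regular unipotent exp(2N), which gives the order p.  The polarity [out
    mx_form] commutes with t0, t1, t2, so <t0, t1, t2> lies in the product of
    this polarity with the orthogonal group of a conic; conjugating by kappa,
    <t1, t2, t3> lies in the centralizer of a second polarity [out mx_form'].
    The two symmetric forms belong, up to a scalar, to the pencil invariant
    under the dihedral group <t1, t2>.  That scalar, w^2, is what makes t0 and t3
    commute.

    Intersection property.  By [intersection_property] only the consecutive
    intervals of generators matter, and all of them but one are settled by
    counting.  The last one is <t0, t1, t2> meet <t1, t2, t3>
    ([gens012_meet_gens123]).  An element of it commutes with both polarities,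
    hence with their product, which is w times a unipotent matrix.  An outer
    element would conjugate that product to its inverse transpose, whose
    eigenvalue is w^2: there is none.  The inner ones preserve both forms, and
    they make up <t1, t2>.

    Unravelling.  Modulo the scalars the obstruction disappears.  The element
    [common] is an outer element of <t0, t1, t2>, and a scalar multiple of it
    lies in <t1, t2, t3>, while <t1, t2> is inner; so the images of the t_i
    violate the intersection property in the quotient by the centre.  A normal
    subgroup that does not consist of scalars contains SL_3(p)
    ([normal_SL_or_scalar]), and then t1 and t2 have the same image.

    Generation.  <t0, t1, t2> contains the matrices exp(xN) and exp(x N^T), that
    is, a copy of PSL_2(p).  A diagonal matrix of it and the conjugate of this
    matrix by the unipotent that moves the first conic to the second differ by
    a transvection ([mem_elem02]), and from it all elementary matrices are
    obtained. *)

(** * Three by three matrices given by their entries *)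

Section Matrix3.

Local Open Scope ring_scope.

Variable F : comNzRingType.
Implicit Types (A B : 'M[F]_3).

Definition mx3 (a b c d e f g h i : F) : 'M[F]_3 :=
  \matrix_(r, s) nth 0 (nth [::] [:: [:: a; b; c]; [:: d; e; f]; [:: g; h; i]] r) s.

Lemma mx3_ind (P : 'M[F]_3 -> Type) :
  (forall a b c d e f g h i, P (mx3 a b c d e f g h i)) -> forall A, P A.
Proof.
move=> PA A; suff ->: A = mx3 (A 0 0) (A 0 1) (A 0 2%:R) (A 1 0) (A 1 1) (A 1 2%:R)
                 (A 2%:R 0) (A 2%:R 1) (A 2%:R 2%:R) by apply: PA.
apply/matrixP=> i j; rewrite mxE.
by case: i => [] [|[|[|]]] // ?; case: j => [] [|[|[|]]] // ? /=;
  congr (A _ _); apply: val_inj.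
Qed.

Lemma mx3_inj a b c d e f g h i a' b' c' d' e' f' g' h' i' :
  mx3 a b c d e f g h i = mx3 a' b' c' d' e' f' g' h' i' ->
  [/\ [/\ a = a', b = b' & c = c'], [/\ d = d', e = e' & f = f']
    & [/\ g = g', h = h' & i = i']].
Proof.
move/matrixP=> E; split; split.
- by have := E 0 0; rewrite !mxE.
- by have := E 0 1; rewrite !mxE.
- by have := E 0 2%:R; rewrite !mxE.
- by have := E 1 0; rewrite !mxE.
- by have := E 1 1; rewrite !mxE.
- by have := E 1 2%:R; rewrite !mxE.
- by have := E 2%:R 0; rewrite !mxE.
- by have := E 2%:R 1; rewrite !mxE.
- by have := E 2%:R 2%:R; rewrite !mxE.
Qed.

Lemma mx3_mul a b c d e f g h i a' b' c' d' e' f' g' h' i' :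
  mx3 a b c d e f g h i *m mx3 a' b' c' d' e' f' g' h' i' =
  mx3 (a * a' + b * d' + c * g') (a * b' + b * e' + c * h')
      (a * c' + b * f' + c * i')
      (d * a' + e * d' + f * g') (d * b' + e * e' + f * h')
      (d * c' + e * f' + f * i')
      (g * a' + h * d' + i * g') (g * b' + h * e' + i * h')
      (g * c' + h * f' + i * i').
Proof.
apply/matrixP=> r s; rewrite !mxE !big_ord_recl big_ord0 !mxE /= addr0 addrA.
by case: r => [] [|[|[|]]] // ?; case: s => [] [|[|[|]]].
Qed.

Lemma mx3_scal k : k%:M = mx3 k 0 0 0 k 0 0 0 k.
Proof.
apply/matrixP=> r s; rewrite !mxE.
by case: r => [] [|[|[|]]] // ?; case: s => [] [|[|[|]]].
Qed.

Lemma mx3_det a b c d e f g h i :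
  \det (mx3 a b c d e f g h i) =
  a * (e * i - f * h) - b * (d * i - f * g) + c * (d * h - e * g).
Proof.
rewrite (expand_det_row _ 0) !big_ord_recl big_ord0 /cofactor !mxE /=.
rewrite !(expand_det_row _ 0) !big_ord_recl big_ord0 /cofactor !mxE /=.
rewrite !det_mx11 !mxE /= /bump /= !big_ord0 !addn0 !exprS !expr0.
ring.
Qed.

Lemma mx3_adj_tr a b c d e f g h i :
  (\adj (mx3 a b c d e f g h i))^T =
  mx3 (e * i - f * h) (f * g - d * i) (d * h - e * g)
      (c * h - b * i) (a * i - c * g) (b * g - a * h)
      (b * f - c * e) (c * d - a * f) (a * e - b * d).
Proof.
apply/matrixP=> r s; rewrite !mxE /cofactor.
case: r => [] [|[|[|]]] // ?; case: s => [] [|[|[|]]] // ? /=;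
 rewrite (expand_det_row _ 0) !big_ord_recl big_ord0 /cofactor !mxE /=;
rewrite !det_mx11 !mxE /= /bump /= ?addn0 ?add0n ?addn1 !exprS !expr0;
ring.
Qed.

End Matrix3.

(** * Elements of the extension of SL_3 by the transpose inverse *)

Section Model.

Local Open Scope group_scope.
Local Open Scope ring_scope.

Variable F : finFieldType.
Implicit Types (A B C : 'M[F]_3).

(** Total, with value 1 on singular matrices, so that [inn] and [out] take a bare
    matrix; all their rules assume determinant 1. *)
Definition toGL A : {'GL_3[F]} := insubd (1%g : {'GL_3[F]}) A.

Definition inn A : SL_invtr 3 F :=
  sdpair1 (invtr_action 3 F) (toGL A).

Definition tau : SL_invtr 3 F := sdpair2 (invtr_action 3 F) (invtr_aut 3 F).

Definition out A : SL_invtr 3 F := (inn A * tau)%g.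

(** The matrix of cofactors: on matrices of determinant 1 this is the inverse
    transpose, but its entries are polynomials, so that identities between words
    in [inn] and [out] become ring identities. *)
Definition itr A : 'M[F]_3 := (\adj A)^T.

Lemma det_unit A : \det A = 1 -> A \is a GRing.unit.
Proof. by move=> dA; rewrite -[_ \is a _]/(A \in unitmx) unitmxE dA unitr1. Qed.

Lemma val_toGL A : \det A = 1 ->
  GLval (toGL A) = A.
Proof. by move=> dA; rewrite [LHS]insubdK //; apply: det_unit. Qed.

Lemma toGL_SL A : \det A = 1 -> toGL A \in SL 3 F.
Proof. by move=> dA; rewrite inE val_toGL // dA. Qed.

Lemma toGLM A B : \det A = 1 -> \det B = 1 ->
  toGL (A *m B) =
  (toGL A * toGL B)%g.
Proof.
move=> dA dB; apply: val_inj.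
change (GLval (toGL (A *m B)) = GLval (toGL A * toGL B)%g).
by rewrite GL_MxE !val_toGL // det_mulmx dA dB mulr1.
Qed.

Lemma det_adj A : \det A = 1 -> \det (\adj A) = 1.
Proof. by move=> dA; rewrite -[LHS]mul1r -{1}dA -det_mulmx mul_mx_adj dA det1. Qed.

Lemma det_itr A : \det A = 1 -> \det (itr A) = 1.
Proof. by move=> dA; rewrite det_tr det_adj. Qed.

Lemma itr_invmx A : \det A = 1 -> itr A = invmx A^T.
Proof.
by move=> dA; rewrite -trmx_inv /itr /invmx unitmxE dA unitr1 invr1 scale1r.
Qed.

Lemma det_mul1 A B : \det A = 1 -> \det B = 1 -> \det (A *m B) = 1.
Proof. by move=> dA dB; rewrite det_mulmx dA dB mulr1. Qed.

Lemma innM A B : \det A = 1 -> \det B = 1 ->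
  (inn A * inn B = inn (A *m B))%g.
Proof. by move=> dA dB; rewrite /inn toGLM // morphM ?toGL_SL. Qed.

Lemma inn1 : inn 1%:M = 1%g.
Proof.
rewrite /inn -[RHS](morph1 (sdpair1 (invtr_action 3 F))).
congr (sdpair1 _ _); apply: val_inj.
by rewrite -[LHS]/(GLval _) val_toGL // det1.
Qed.

Lemma invtr_aut_cycle : invtr_aut 3 F \in <[invtr_aut 3 F]>%g.
Proof. exact: cycle_id. Qed.

Lemma tauK : (tau * tau = 1)%g.
Proof.
rewrite /tau -morphM ?invtr_aut_cycle //.
suff -> : (invtr_aut 3 F * invtr_aut 3 F = 1)%g by rewrite morph1.
by have := expg_order (invtr_aut 3 F); rewrite order_invtr_aut expg2.
Qed.

Lemma tau_inn A : \det A = 1 -> (tau * inn A = inn (itr A) * tau)%g.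
Proof.
move=> dA.
suff ->: (inn (itr A) = inn A ^ tau^-1)%g by rewrite conjgE invgK -!mulgA mulVg mulg1.
have tV : (tau^-1 = tau)%g.
  by apply/eqP; rewrite eq_invg_mul tauK.
rewrite tV /inn /tau -sdpair_act ?invtr_aut_cycle ?toGL_SL //.
congr (sdpair1 _ _); rewrite -[RHS]/(invtr_aut 3 F (toGL A)).
rewrite invtr_autE ?toGL_SL //; apply: val_inj => /=.
rewrite -[LHS]/(GLval _) -/(GLval (toGL A)) !val_toGL ?det_itr //.
exact: itr_invmx.
Qed.

Lemma inn_out A B : \det A = 1 -> \det B = 1 ->
  (inn A * out B = out (A *m B))%g.
Proof. by move=> dA dB; rewrite /out mulgA innM. Qed.

Lemma out_inn A B : \det A = 1 -> \det B = 1 ->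
  (out A * inn B = out (A *m itr B))%g.
Proof. by move=> dA dB; rewrite /out -mulgA tau_inn // mulgA innM // det_itr. Qed.

Lemma out_out A B : \det A = 1 -> \det B = 1 ->
  (out A * out B = inn (A *m itr B))%g.
Proof.
by move=> dA dB; rewrite {2}/out mulgA out_inn // /out -mulgA tauK mulg1.
Qed.

Lemma inn_inj A B : \det A = 1 -> \det B = 1 -> inn A = inn B -> A = B.
Proof.
move=> dA dB /(injmP (injm_sdpair1 _)) E.
have /(congr1 (@GLval _ _)) := E (toGL_SL dA) (toGL_SL dB).
by rewrite !val_toGL.
Qed.

Lemma out_inj A B : \det A = 1 -> \det B = 1 -> out A = out B -> A = B.
Proof. by move=> dA dB /mulIg; apply: inn_inj. Qed.

Lemma inn_neq_out A B : \det A = 1 -> \det B = 1 -> inn A <> out B.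
Proof.
move=> dA dB E.
have dB' := det_adj dB.
have dBA : \det (\adj B *m A) = 1 by apply: det_mul1.
have tB : tau = inn (\adj B *m A).
  by rewrite -innM // E inn_out // mul_adj_mx dB /out inn1 mul1g.
have t1 : tau = 1%g.
  apply/set1gP; have /setP/(_ tau) <- := im_sdpair_TI (invtr_action 3 F).
  apply/setIP; split; last by rewrite mem_morphim ?invtr_aut_cycle.
  by rewrite tB; apply: mem_morphim; apply: toGL_SL.
have E2 : tau = sdpair2 (invtr_action 3 F) 1%g by rewrite t1; apply/esym/morph1.
have inj2 := injmP (injm_sdpair2 (invtr_action 3 F)).
have /eqP := inj2 _ _ invtr_aut_cycle (group1 _) E2.
by rewrite -order_eq1 order_invtr_aut.
Qed.

Lemma SL_invtr_ind (P : SL_invtr 3 F -> Prop) :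
  (forall A, \det A = 1 -> P (inn A)) -> (forall A, \det A = 1 -> P (out A)) ->
  forall g, P g.
Proof.
move=> Pi Po g.
have: g \in [set: SL_invtr 3 F] by rewrite inE.
have /setP/(_ g) <- := im_sdpair (invtr_action 3 F).
case/mulsgP=> _ _ /morphimP[A _ SA ->] /morphimP[s _ Ss ->] ->.
have dA : \det (GLval A) = 1 by apply/eqP; move: SA; rewrite inE.
have iA : inn (GLval A) = sdpair1 (invtr_action 3 F) A.
  rewrite /inn; congr (sdpair1 _ _).
  by apply: val_inj; rewrite -[LHS]/(GLval _) val_toGL.
rewrite -[X in P (X * _)%g]iA {iA}.
case/cycleP: Ss => n ->.
have -> : (sdpair2_morphism (invtr_action 3 F) (invtr_aut 3 F ^+ n)
           = tau ^+ odd n)%g.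
  rewrite morphX ?invtr_aut_cycle //; change (tau ^+ n = tau ^+ odd n)%g.
  rewrite -{1}(odd_double_half n) expgD -mul2n expgM expg2 tauK expg1n.
  by rewrite mulg1.
case: (odd n); last by rewrite mulg1; apply: Pi.
exact: Po.
Qed.

(** The index 2 subgroup, used to tell apart inner and outer elements. *)
Definition Inn : {group SL_invtr 3 F} := (sdpair1 (invtr_action 3 F) @* SL 3 F)%G.

Lemma inn_Inn A : \det A = 1 -> inn A \in Inn.
Proof. by move=> dA; apply: mem_morphim; apply: toGL_SL. Qed.

Lemma out_notin_Inn A : \det A = 1 -> out A \notin Inn.
Proof.
move=> dA; apply/negP=> /morphimP[B _ SB] E.
have dB : \det (GLval B) = 1 by apply/eqP; move: SB; rewrite inE.
have iB : inn (GLval B) = sdpair1 (invtr_action 3 F) B.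
  rewrite /inn; congr (sdpair1 _ _).
  by apply: val_inj; rewrite -[LHS]/(GLval _) val_toGL.
by apply: (inn_neq_out dB dA); rewrite iB.
Qed.

End Model.

(** * Reduction of the intersection property to consecutive intervals *)

(** Membership hypotheses that do not concern indices are dropped first, since
    otherwise [lia] translates all of them and becomes very slow. *)
Ltac index_lia :=
  repeat match goal with
  | H : is_true (@in_mem ?T _ _) |- _ =>
    lazymatch T with ordinal _ => fail | _ => clear H end
  end; lia.

Section Intervals.

Local Open Scope group_scope.

Variables (gT : finGroupType) (n : nat) (t : n.-tuple gT).
Implicit Types J K : {set 'I_n}.

Definition itv (a b : nat) : {set 'I_n} := [set i : 'I_n | a <= i < b].

Local Notation G J := (Defs.sub_gen t J).

Lemma sub_gen_group J : group_set (G J).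
Proof. exact: groupP. Qed.
Canonical sub_gen_Group J := Group (sub_gen_group J).

Lemma sub_genS J K : J \subset K -> G J \subset G K.
Proof. by move=> sJK; apply/genS/imsetS. Qed.

Lemma mem_sub_gen i J : i \in J -> tnth t i \in G J.
Proof. by move=> iJ; apply/mem_gen/imset_f. Qed.

Lemma sub_gen0 : G set0 = 1.
Proof. by rewrite /Defs.sub_gen imset0 gen0. Qed.

Hypothesis far_commute :
  forall i j : 'I_n, i.+1 < j -> commute (tnth t i) (tnth t j).

(** Removing one index from the diagram leaves two sets of generators that
    commute with each other. *)
Lemma sub_gen_split k J x : (forall i, i \in J -> i != k :> nat) ->
  x \in G J ->
  exists y z, [/\ y \in G (J :&: itv 0 k), z \in G (J :&: itv k.+1 n)
                & x = y * z].
Proof.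
move=> Jk.
have cc : G (J :&: itv k.+1 n) \subset 'C(G (J :&: itv 0 k)).
  rewrite /Defs.sub_gen cent_gen gen_subG; apply/subsetP=> _ /imsetP[j Jj ->].
  apply/centP=> _ /imsetP[i Ji ->]; apply/commute_sym/far_commute.
  by move: Ji Jj; rewrite !inE; index_lia.
have EJ : G J \subset G (J :&: itv 0 k) <*> G (J :&: itv k.+1 n).
  rewrite gen_subG; apply/subsetP=> _ /imsetP[j Jj ->].
  have := Jk _ Jj; rewrite neq_ltn => /orP[lt|lt].
    by apply: (subsetP (joing_subl _ _)); apply: mem_sub_gen; rewrite !inE Jj.
  apply: (subsetP (joing_subr _ _)); apply: mem_sub_gen.
  by rewrite !inE Jj lt ltn_ord.
move/(subsetP EJ); rewrite /= cent_joinEr // => /mulsgP[y z yP zP ->].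
by exists y, z.
Qed.

Lemma mem_sub_genS J K x : x \in G J ->
  (forall i, i \in J -> i \in K) -> x \in G K.
Proof. by move=> xJ sJK; apply: (subsetP (sub_genS _)) xJ; apply/subsetP. Qed.

Hypothesis itv_inter : forall a b, a < b -> b < n ->
  G (itv a b) :&: G (itv a.+1 b.+1) \subset G (itv a.+1 b).

(** Induction on the length of the interval, where J and K may be assumed to have
    gaps, for otherwise the claim is trivial.  If K avoids the last index, then
    [itv_inter] removes this index from the factor to the right of the gap of J,
    and induction applies; the first index is treated in the same way.  In
    general, let k <= m be gaps of J and K.  The factorizations of x at these gaps
    differ by an element generated by the indices strictly between k and m, and
    this element is then seen to involve only indices of K. *)
Lemma sub_gen_inter_itv d : forall a J K,
  J \subset itv a (a + d) -> K \subset itv a (a + d) ->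
  forall x, x \in G J -> x \in G K -> x \in G (J :&: K).
Proof.
elim: d => [|d IHd] a J K; rewrite ?addn0.
  move=> /subsetP sJ _ x xJ _.
  apply: (mem_sub_genS xJ) => i /sJ; rewrite !inE; index_lia.
have IHl := IHd a; have IHr := IHd a.+1; move: IHl IHr {IHd}.
rewrite addSn addnS; set b := a + d => IHl IHr.
have [bn|nb] := ltnP b n; last first.
  have -> : itv a b.+1 = itv a b.
    by apply/setP=> i; rewrite !inE; have := ltn_ord i; lia.
  exact: IHl.
have le_ab : a <= b by rewrite leq_addr.
have itv_inter' x : x \in G (itv a b) -> x \in G (itv a.+1 b.+1) ->
    x \in G (itv a.+1 b).
  move=> x1 x2; have [ab|ba] := ltnP a b.
    by apply: (subsetP (itv_inter ab bn)); rewrite inE x1.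
  by apply: (mem_sub_genS x1) => i; rewrite !inE; index_lia.
have low J' K' k x : J' \subset itv a b.+1 -> K' \subset itv a b ->
    a <= k <= b -> (forall i, i \in J' -> i != k :> nat) ->
    x \in G J' -> x \in G K' -> x \in G (J' :&: K').
  move=> /subsetP sJ /subsetP sK kab Jk xJ xK.
  have [y [z [yJ zJ def_x]]] := sub_gen_split Jk xJ.
  have y_ab : y \in G (itv a b).
    by apply: (mem_sub_genS yJ) => i; rewrite !inE => /andP[/sJ];
      rewrite ?inE; index_lia.
  have x_ab : x \in G (itv a b) by apply: (mem_sub_genS xK).
  have z_ab : z \in G (itv a b) by rewrite -(groupMl _ y_ab) -def_x.
  have z_ab' : z \in G (itv a.+1 b.+1).
    by apply: (mem_sub_genS zJ) => i; rewrite !inE => /andP[/sJ];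
      rewrite ?inE; index_lia.
  have z_J : z \in G (J' :&: itv k.+1 n :&: itv a.+1 b).
    apply: IHr => //; last exact: itv_inter'.
      by apply/subsetP=> i; rewrite !inE => /andP[/sJ];
      rewrite ?inE; index_lia.
    by apply/subsetP=> i; rewrite !inE; index_lia.
  have x_J : x \in G (J' :&: itv a b).
    rewrite def_x groupM //.
      apply: (mem_sub_genS yJ) => i; rewrite !inE => /andP[iJ].
      by have := sJ _ iJ; rewrite iJ inE; index_lia.
    by apply: (mem_sub_genS z_J) => i; rewrite !inE; index_lia.
  apply: (@mem_sub_genS (J' :&: itv a b :&: K')); last first.
    by move=> i; rewrite !inE; index_lia.
  by apply: IHl => //; apply/subsetP=> // i; rewrite !inE; index_lia.
have high J' K' k x : J' \subset itv a b.+1 -> K' \subset itv a.+1 b.+1 ->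
    a <= k <= b -> (forall i, i \in J' -> i != k :> nat) ->
    x \in G J' -> x \in G K' -> x \in G (J' :&: K').
  move=> /subsetP sJ /subsetP sK kab Jk xJ xK.
  have [y [z [yJ zJ def_x]]] := sub_gen_split Jk xJ.
  have z_ab : z \in G (itv a.+1 b.+1).
    by apply: (mem_sub_genS zJ) => i; rewrite !inE => /andP[/sJ];
      rewrite ?inE; index_lia.
  have x_ab : x \in G (itv a.+1 b.+1) by apply: (mem_sub_genS xK).
  have y_ab : y \in G (itv a.+1 b.+1) by rewrite -(groupMr _ z_ab) -def_x.
  have y_ab' : y \in G (itv a b).
    by apply: (mem_sub_genS yJ) => i; rewrite !inE => /andP[/sJ];
      rewrite ?inE; index_lia.
  have y_J : y \in G (J' :&: itv 0 k :&: itv a.+1 b).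
    apply: IHl => //; last exact: itv_inter'.
      by apply/subsetP=> i; rewrite !inE => /andP[/sJ];
      rewrite ?inE; index_lia.
    by apply/subsetP=> i; rewrite !inE; index_lia.
  have x_J : x \in G (J' :&: itv a.+1 b.+1).
    rewrite def_x groupM //.
      by apply: (mem_sub_genS y_J) => i; rewrite !inE; index_lia.
    apply: (mem_sub_genS zJ) => i; rewrite !inE => /andP[iJ].
    by have := sJ _ iJ; rewrite iJ inE; index_lia.
  apply: (@mem_sub_genS (J' :&: itv a.+1 b.+1 :&: K')); last first.
    by move=> i; rewrite !inE; index_lia.
  by apply: IHr => //; apply/subsetP=> // i; rewrite !inE; index_lia.
have core J' K' k m x : J' \subset itv a b.+1 -> K' \subset itv a b.+1 ->
    a <= k -> k <= m -> m <= b -> (forall i, i \in J' -> i != k :> nat) ->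
    (forall i, i \in K' -> i != m :> nat) ->
    x \in G J' -> x \in G K' -> x \in G (J' :&: K').
  move=> /subsetP sJ /subsetP sK ak km mb Jk Km xJ xK.
  have [g1 [g2 [g1J g2J def_x]]] := sub_gen_split Jk xJ.
  have [h1 [h2 [h1K h2K def_x']]] := sub_gen_split Km xK.
  (* q is the discrepancy between the two factorizations of x *)
  pose q := h1^-1 * g1.
  have qE : q = h2 * g2^-1.
    by apply: (mulgI h1); apply: (mulIg g2);
      rewrite /q mulKVg -def_x def_x' !mulgA mulgKV.
  have q1 : q \in G (itv a m).
    rewrite groupM ?groupV //.
      by apply: (mem_sub_genS h1K) => i; rewrite !inE => /andP[/sK];
      rewrite ?inE; index_lia.
    by apply: (mem_sub_genS g1J) => i; rewrite !inE => /andP[/sJ];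
      rewrite ?inE; index_lia.
  have q2 : q \in G (itv k.+1 b.+1).
    rewrite qE groupM ?groupV //.
      by apply: (mem_sub_genS h2K) => i; rewrite !inE => /andP[/sK];
      rewrite ?inE; index_lia.
    by apply: (mem_sub_genS g2J) => i; rewrite !inE => /andP[/sJ];
      rewrite ?inE; index_lia.
  have q3 : q \in G (itv a.+1 b).
    apply: itv_inter'; first by apply: (mem_sub_genS q1) => i; rewrite !inE; index_lia.
    by apply: (mem_sub_genS q2) => i; rewrite !inE; index_lia.
  have q4 : q \in G (itv a.+1 m).
    apply: (@mem_sub_genS (itv a m :&: itv a.+1 b)); last first.
      by move=> i; rewrite !inE; index_lia.
    by apply: IHl => //; apply/subsetP=> i; rewrite !inE; index_lia.
  have q5 : q \in G (itv k.+1 m).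
    apply: (@mem_sub_genS (itv a.+1 m :&: itv k.+1 b.+1)); last first.
      by move=> i; rewrite !inE; index_lia.
    by apply: IHr => //; apply/subsetP=> i; rewrite !inE; index_lia.
  have h1S : h1 \in G ((K' :&: itv 0 m) :&: (J' :&: itv 0 k :|: itv k.+1 m)).
    apply: IHl => //.
    - by apply/subsetP=> i; rewrite !inE => /andP[/sK];
      rewrite ?inE; index_lia.
    - apply/subsetP=> i; rewrite !inE => /orP[/andP[/sJ]|]; rewrite ?inE; index_lia.
    have -> : h1 = g1 * q^-1 by rewrite /q invMg invgK mulgA mulgV mul1g.
    rewrite groupM ?groupV //.
      by apply: (mem_sub_genS g1J) => i; rewrite !inE => ->.
    by apply: (mem_sub_genS q5) => i; rewrite !inE => ->; rewrite orbT.
  have [|e [f [eS fS def_h1]]] := sub_gen_split (k := k) _ h1S.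
    by move=> i; rewrite !inE; index_lia.
  have eq1 : e^-1 * g1 = 1.
    apply/set1gP; rewrite -sub_gen0.
    apply: (@mem_sub_genS (itv a k :&: itv k.+1 m)); last first.
      by move=> i; rewrite !inE; index_lia.
    apply: IHl; try by apply/subsetP=> i; rewrite !inE; index_lia.
      rewrite groupM ?groupV //.
        apply: (mem_sub_genS eS) => i; rewrite !inE => /andP[/andP[/andP[/sK]]].
        by rewrite ?inE; index_lia.
      by apply: (mem_sub_genS g1J) => i; rewrite !inE => /andP[/sJ];
      rewrite ?inE; index_lia.
    have -> : e^-1 * g1 = f * q by rewrite /q def_h1 invMg !mulgA mulgV mul1g.
    rewrite groupM //.
    by apply: (mem_sub_genS fS) => i; rewrite !inE; index_lia.
  have g1E : g1 = e by apply: (mulgI e^-1); rewrite eq1 mulVg.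
  have g1S : g1 \in G (J' :&: K').
    by rewrite g1E; apply: (mem_sub_genS eS) => i; rewrite !inE; index_lia.
  rewrite def_x groupM //.
  apply: (@mem_sub_genS ((J' :&: itv k.+1 n) :&: (K' :&: itv k.+1 n))); last first.
    by move=> i; rewrite !inE; index_lia.
  apply: IHr => //.
  - by apply/subsetP=> i; rewrite !inE => /andP[/sJ];
      rewrite ?inE; index_lia.
  - by apply/subsetP=> i; rewrite !inE => /andP[/sK];
      rewrite ?inE; index_lia.
  have -> : g2 = f * h2.
    by apply: (mulgI g1); rewrite -def_x def_x' def_h1 g1E mulgA.
  rewrite groupM //.
    by apply: (mem_sub_genS fS) => i; rewrite !inE; index_lia.
  by apply: (mem_sub_genS h2K) => i; rewrite !inE => /and3P[-> mi ->];
    rewrite (leq_ltn_trans km mi).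
have full J' : J' \subset itv a b.+1 ->
    J' = itv a b.+1 \/ exists2 k, a <= k <= b & forall i, i \in J' -> i != k :> nat.
  move=> sJ; have [sIJ|/subsetPn[k kI kJ]] := boolP (itv a b.+1 \subset J').
    by left; apply/eqP; rewrite eqEsubset sJ.
  right; exists (k : nat); first by move: kI; rewrite inE.
  by move=> i iJ; apply: contraNneq kJ => /val_inj <-.
move=> sJ sK x xJ xK.
have [->|[k kab Jk]] := full J sJ; first by rewrite (setIidPr sK).
have [->|[m mab Km]] := full K sK; first by rewrite (setIidPl sJ).
have [km|/ltnW mk] := leqP k m.
  by apply: (core J K k m) => //; lia.
by rewrite setIC; apply: (core K J m k) => //; lia.
Qed.

(** The criterion of McMullen and Schulte for string C-groups, unfolded down to
    intervals of length one. *)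
Theorem intersection_property J K : G J :&: G K = G (J :&: K).
Proof.
apply/eqP; rewrite eqEsubset subsetI sub_genS ?subsetIl //.
rewrite sub_genS ?subsetIr // !andbT; apply/subsetP=> x /setIP[xJ xK].
have sT (L : {set 'I_n}) : L \subset itv 0 (0 + n).
  by apply/subsetP=> i _; rewrite inE ltn_ord.
exact: (sub_gen_inter_itv (sT J) (sT K)).
Qed.

End Intervals.

(** * Elementary matrices and normal subgroups *)

Section Elementary.

Local Open Scope ring_scope.

Variable F : finFieldType.
Implicit Types (A B C : 'M[F]_3) (N H : {group SL_invtr 3 F}).

Definition elem (i j : 'I_3) (x : F) : 'M[F]_3 := 1%:M + x *: delta_mx i j.

Lemma elemE x :
  (elem 0 1 x = mx3 1 x 0 0 1 0 0 0 1) * (elem 0 2 x = mx3 1 0 x 0 1 0 0 0 1) *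
  (elem 1 0 x = mx3 1 0 0 x 1 0 0 0 1) * (elem 1 2 x = mx3 1 0 0 0 1 x 0 0 1) *
  (elem 2 0 x = mx3 1 0 0 0 1 0 x 0 1) * (elem 2 1 x = mx3 1 0 0 0 1 0 0 x 1).
Proof.
by do !split; rewrite /elem; apply/matrixP=> r s; rewrite !mxE;
  case: r => [] [|[|[|]]] // ?; case: s => [] [|[|[|]]] // ? /=;
  rewrite ?mulr1 ?mulr0 ?addr0 ?add0r.
Qed.

Lemma ord3_ind (P : 'I_3 -> Prop) : P 0 -> P 1 -> P 2 -> forall i, P i.
Proof.
move=> P0 P1 P2 [[|[|[|]]] // i].
- by rewrite (_ : Ordinal i = 0) //; apply: val_inj.
- by rewrite (_ : Ordinal i = 1) //; apply: val_inj.
- by rewrite (_ : Ordinal i = 2) //; apply: val_inj.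
Qed.

Lemma det_elem i j x : i != j -> \det (elem i j x) = 1.
Proof.
elim/ord3_ind: i; elim/ord3_ind: j => // _; rewrite elemE mx3_det; ring.
Qed.

Definition contains_elem H := forall i j x, i != j -> inn (elem i j x) \in H.

Lemma inn_cancell H A B : \det A = 1 -> \det B = 1 -> inn A \in H ->
  inn (A *m B) \in H -> inn B \in H.
Proof. by move=> dA dB AH; rewrite -innM // groupMl. Qed.

Lemma inn_cancelr H A B : \det A = 1 -> \det B = 1 -> inn A \in H ->
  inn (B *m A) \in H -> inn B \in H.
Proof. by move=> dA dB AH; rewrite -innM // groupMr. Qed.

(** Gaussian elimination.  [S4] makes the corner entry equal to 1, [S3] clears the
    first row and column, and [S2] and [S1] do the same for the remaining block;
    the determinant forces the last pivot to be 1. *)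
Lemma contains_elem_SL H : contains_elem H -> forall A, \det A = 1 -> inn A \in H.
Proof.
move=> EH.
have lE i j x A : i != j -> \det A = 1 -> inn (elem i j x *m A) \in H ->
    inn A \in H.
  by move=> ij dA; apply: inn_cancell; rewrite ?det_elem ?EH.
have rE i j x A : i != j -> \det A = 1 -> inn (A *m elem i j x) \in H ->
    inn A \in H.
  by move=> ij dA; apply: inn_cancelr; rewrite ?det_elem ?EH.
have S1 f h i : \det (mx3 1 0 0 0 1 f 0 h i) = 1 ->
    inn (mx3 1 0 0 0 1 f 0 h i) \in H.
  move=> d1; apply: (lE 2 1 (- h)) => //; apply: (rE 1 2 (- f)) => //.
    by rewrite det_mul1 ?det_elem.
  rewrite !elemE !mx3_mul; move: d1; rewrite mx3_det => d1.
  rewrite [X in inn X](_ : _ = 1%:M) ?inn1 ?group1 //.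
  rewrite mx3_scal; congr mx3; try ring.
  by rewrite -[RHS]d1; ring.
have S2' e f h i : h != 0 -> \det (mx3 1 0 0 0 e f 0 h i) = 1 ->
    inn (mx3 1 0 0 0 e f 0 h i) \in H.
  move=> h0 d1; apply: (lE 1 2 ((1 - e) / h)) => //.
  have d2 : \det (elem 1 2 ((1 - e) / h) *m mx3 1 0 0 0 e f 0 h i) = 1.
    by rewrite det_mul1 ?det_elem.
  move: d2; rewrite !elemE !mx3_mul.
  set A := mx3 _ _ _ _ _ _ _ _ _.
  have -> : A = mx3 1 0 0 0 1 (f + (1 - e) / h * i) 0 h i.
    by rewrite /A; congr mx3; field.
  exact: S1.
have S2 e f h i : \det (mx3 1 0 0 0 e f 0 h i) = 1 ->
    inn (mx3 1 0 0 0 e f 0 h i) \in H.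
  move=> d1; have [h0|] := eqVneq h 0; last by move=> h0; apply: S2'.
  have e0 : e != 0.
    by apply: contra_eq_neq d1 => ->; rewrite mx3_det h0 eq_sym -subr_eq0;
       rewrite (_ : _ - _ = 1) ?oner_eq0 //; ring.
  apply: (lE 2 1 1) => //.
  have d2 : \det (elem 2 1 1 *m mx3 1 0 0 0 e f 0 h i) = 1.
    by rewrite det_mul1 ?det_elem.
  move: d2; rewrite !elemE !mx3_mul.
  set A := mx3 _ _ _ _ _ _ _ _ _.
  have -> : A = mx3 1 0 0 0 e f 0 e (f + i).
    by rewrite /A h0; congr mx3; ring.
  exact: S2'.
have S3 b c d e f g h i : \det (mx3 1 b c d e f g h i) = 1 ->
    inn (mx3 1 b c d e f g h i) \in H.
  move=> d1; apply: (lE 1 0 (- d)) => //; apply: (lE 2 0 (- g)) => //.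
    by rewrite det_mul1 ?det_elem.
  have d2 : \det (elem 2 0 (- g) *m (elem 1 0 (- d) *m mx3 1 b c d e f g h i)) = 1.
    by rewrite !det_mul1 ?det_elem.
  apply: (rE 0 1 (- b)) => //; apply: (rE 0 2 (- c)) => //.
    by rewrite det_mul1 ?det_elem.
  have: \det (elem 2 0 (- g) *m (elem 1 0 (- d) *m mx3 1 b c d e f g h i)
              *m elem 0 1 (- b) *m elem 0 2 (- c)) = 1.
    by rewrite !det_mul1 ?det_elem.
  rewrite !elemE !mx3_mul; set A := mx3 _ _ _ _ _ _ _ _ _.
  have -> : A = mx3 1 0 0 0 (e - d * b) (f - d * c) 0 (h - g * b) (i - g * c).
    by rewrite /A; congr mx3; ring.
  exact: S2.
have S4 a b c d e f g h i : d != 0 -> \det (mx3 a b c d e f g h i) = 1 ->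
    inn (mx3 a b c d e f g h i) \in H.
  move=> d0 d1; apply: (lE 0 1 ((1 - a) / d)) => //.
  have: \det (elem 0 1 ((1 - a) / d) *m mx3 a b c d e f g h i) = 1.
    by rewrite !det_mul1 ?det_elem.
  rewrite !elemE !mx3_mul; set A := mx3 _ _ _ _ _ _ _ _ _.
  set y := (1 - a) / d.
  have -> : A = mx3 1 (b + y * e) (c + y * f) d e f g h i.
    by rewrite /A /y; congr mx3; field.
  exact: S3.
elim/mx3_ind=> a b c d e f g h i dA.
have [d0|] := eqVneq d 0; last by move=> d0; apply: S4.
pose x := if g == 0 then elem 1 0 1 else elem 1 2 1 : 'M[F]_3.
have dx : \det x = 1 by rewrite /x; case: ifP => _; rewrite det_elem.
have xH : inn x \in H by rewrite /x; case: ifP => _; rewrite EH.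
apply: (inn_cancell dx dA xH).
have := det_mul1 dx dA; rewrite /x; case: eqP => g0.
  rewrite elemE mx3_mul; apply: S4.
  rewrite d0 g0 !mul1r !mulr0 !addr0; apply: contra_eq_neq dA => ->.
  by rewrite mx3_det d0 g0 eq_sym -subr_eq0 (_ : _ - _ = 1) ?oner_eq0 //; ring.
by rewrite elemE mx3_mul; apply: S4; rewrite d0 mul0r mulr0 !add0r mul1r; apply/eqP.
Qed.

Section Normal.

Variable N : {group SL_invtr 3 F}.
Hypothesis nN : (N <| [set: SL_invtr 3 F])%g.

Lemma normal_conj g h : h \in N -> (g * h * g^-1)%g \in N.
Proof.
move=> hN; have -> : (g * h * g^-1 = h ^ g^-1)%g by rewrite conjgE invgK mulgA.
by rewrite memJ_norm // (subsetP (normal_norm nN)) ?inE.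
Qed.

(** This is the form in which commutators are used: Z is the commutator
    A B A^-1 B^-1, given without inverses. *)
Lemma normal_comm A B Z : \det A = 1 -> \det B = 1 -> \det Z = 1 ->
  (inn A \in N) || (inn B \in N) -> A *m B = Z *m (B *m A) -> inn Z \in N.
Proof.
move=> dA dB dZ ABN E.
have -> : inn Z = (inn A * inn B * (inn A)^-1 * (inn B)^-1)%g.
  by rewrite innM // E -!innM ?det_mul1 // !mulgA !mulgK.
case/orP: ABN => ?; last by rewrite groupM ?groupV ?normal_conj.
by rewrite -!mulgA groupM // mulgA normal_conj ?groupV.
Qed.

(** The commutator of elem i j x and elem j k y is elem i k (x * y), so one
    elementary matrix in a normal subgroup produces all of them. *)
Lemma normal_elem_all a : a != 0 -> inn (elem 0 2 a) \in N -> contains_elem N.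
Proof.
move=> a0 Na.
have comm i j k x y : i != j -> j != k -> i != k ->
    (inn (elem i j x) \in N) || (inn (elem j k y) \in N) ->
    inn (elem i k (x * y)) \in N.
  move=> ij jk ik ABN; apply: normal_comm ABN _; rewrite ?det_elem //.
  move: ij jk ik; elim/ord3_ind: i; elim/ord3_ind: j; elim/ord3_ind: k => // _ _ _;
  rewrite !elemE !mx3_mul; congr mx3; ring.
have N01 x : inn (elem 0 1 x) \in N.
  have -> : x = a * (x / a) by field.
  apply: (@comm _ 2) => //.
  by rewrite Na.
have N02 x : inn (elem 0 2 x) \in N.
  by rewrite -[x]mulr1; apply: (@comm _ 1) => //; rewrite N01.
have N21 x : inn (elem 2 1 x) \in N.
  by rewrite -[x]mul1r; apply: (@comm _ 0) => //; rewrite N01 orbT.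
have N12 x : inn (elem 1 2 x) \in N.
  by rewrite -[x]mul1r; apply: (@comm _ 0) => //; rewrite N02 orbT.
have N20 x : inn (elem 2 0 x) \in N.
  by rewrite -[x]mulr1; apply: (@comm _ 1) => //; rewrite N21.
have N10 x : inn (elem 1 0 x) \in N.
  by rewrite -[x]mulr1; apply: (@comm _ 2) => //; rewrite N12.
by move=> i j x; elim/ord3_ind: i; elim/ord3_ind: j.
Qed.

Lemma normal_transvection_all u v : (u, v) != (0, 0) ->
  inn (mx3 1 0 u 0 1 v 0 0 1) \in N -> contains_elem N.
Proof.
move=> uv Nuv; have [v0|v0] := eqVneq v 0.
  apply: (@normal_elem_all u).
    by apply: contraNneq uv => ->; rewrite v0.
  by rewrite elemE; rewrite v0 in Nuv.
apply: (@normal_elem_all v) => //.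
apply: (@normal_comm (elem 0 1 1) (mx3 1 0 u 0 1 v 0 0 1));
  rewrite ?det_elem ?Nuv ?orbT //.
  by rewrite mx3_det; ring.
by rewrite !elemE !mx3_mul; congr mx3; ring.
Qed.

(** With A the upper left block of Y, the commutator of Y and the translation by
    a vector v is the translation by A v - v.  So either some translation is
    obtained in this way, or A = 1 and Y itself is one. *)
Lemma normal_parabolic_all a b c d e f :
  let Y := mx3 a b c d e f 0 0 1 in
  \det Y = 1 -> Y != 1%:M -> inn Y \in N -> contains_elem N.
Proof.
move=> Y dY Y1 NY.
have T u v : inn (mx3 1 0 (a * u + b * v - u) 0 1 (d * u + e * v - v) 0 0 1) \in N.
  apply: (@normal_comm Y (mx3 1 0 u 0 1 v 0 0 1)); rewrite ?NY //.
  - by rewrite mx3_det; ring.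
  - by rewrite mx3_det; ring.
  by rewrite !mx3_mul; congr mx3; ring.
have [[E1 E2]|] := eqVneq (a * 1 + b * 0 - 1, d * 1 + e * 0 - 0) (0, 0); last first.
  by move/normal_transvection_all; apply; apply: T.
have [[E3 E4]|] := eqVneq (a * 0 + b * 1 - 0, d * 0 + e * 1 - 1) (0, 0); last first.
  by move/normal_transvection_all; apply; apply: T.
have {E1} a1 : a = 1 by apply/eqP; rewrite -subr_eq0 -E1; apply/eqP; ring.
have {E2} d0 : d = 0 by rewrite -E2; ring.
have {E3} b0 : b = 0 by rewrite -E3; ring.
have {E4} e1 : e = 1 by apply/eqP; rewrite -subr_eq0 -E4; apply/eqP; ring.
move: Y1 NY; rewrite /Y a1 b0 d0 e1 mx3_scal => Y1.
apply: normal_transvection_all; apply: contraNneq Y1 => -[-> ->].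
by [].
Qed.

Lemma last_row_complete (psi : 'rV[F]_3) : psi != 0 ->
  exists2 g : 'M[F]_3, \det g = 1 & row 2 g = psi.
Proof.
move=> psi0; pose x i := psi 0 i.
have psiE u0 u1 u2 v0 v1 v2 :
   row 2 (mx3 u0 u1 u2 v0 v1 v2 (x 0) (x 1) (x 2)) = psi.
  apply/rowP=> j; rewrite !mxE; elim/ord3_ind: j => //=.
have [x2|x2] := eqVneq (x 2) 0; last first.
  exists (mx3 (x 2)^-1 0 0 0 1 0 (x 0) (x 1) (x 2)) => //.
  by rewrite mx3_det; field.
have [x1|x1] := eqVneq (x 1) 0; last first.
  exists (mx3 0 0 (x 1)^-1 1 0 0 (x 0) (x 1) (x 2)) => //.
  by rewrite mx3_det; field.
have x0 : x 0 != 0.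
  apply: contraNneq psi0 => x0; apply/eqP/rowP=> j; rewrite mxE.
  by elim/ord3_ind: j.
exists (mx3 0 (x 0)^-1 0 0 0 1 (x 0) (x 1) (x 2)) => //.
by rewrite mx3_det; field.
Qed.

(** The commutator Y of A and 1 + e_i e_j^T is a product of two transvections with
    centres A e_i and e_i.  It fixes a row vector psi that vanishes on these two
    centres, and after a change of basis psi becomes the last row of the
    identity. *)
Lemma normal_noncomm_all A i j : \det A = 1 -> inn A \in N -> i != j ->
  A *m elem i j 1 != elem i j 1 *m A -> contains_elem N.
Proof.
move=> dA NA ij nAE.
have dE x : \det (elem i j x) = 1 by rewrite det_elem.
pose Y := A *m elem i j 1 *m \adj A *m elem i j (- 1).
have EE : elem i j (- 1) *m elem i j 1 = 1%:M.
  move: ij; elim/ord3_ind: i {nAE Y dE}; elim/ord3_ind: j => // _;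
  rewrite !elemE mx3_mul mx3_scal; congr mx3; ring.
have YE : A *m elem i j 1 = Y *m (elem i j 1 *m A).
  rewrite /Y -[RHS]mulmxA (mulmxA (elem i j (- 1))) EE mul1mx -[RHS]mulmxA.
  by rewrite mul_adj_mx dA mulmx1.
have dY : \det Y = 1 by rewrite !det_mul1 ?det_adj.
have NY : inn Y \in N by apply: (normal_comm dA (dE 1) dY) YE; rewrite NA.
have [psi psi0 [psiA psii]] : exists2 psi : 'rV[F]_3, psi != 0 &
    psi *m (A *m delta_mx i 0) = 0 :> 'M_1 /\ psi *m delta_mx i 0 = 0 :> 'M_1.
  pose M := row_mx (A *m delta_mx i 0) (delta_mx i 0) : 'M[F]_(3, 1 + 1).
  have : kermx M != 0.
    rewrite kermx_eq0 /row_free neq_ltn; apply/orP; left.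
    by apply: leq_ltn_trans (rank_leq_col M) _.
  case/rowV0Pn=> psi /sub_kermxP psiM psi0; exists psi => //.
  by apply: eq_row_mx; rewrite -mul_mx_row row_mx0.
have psiY : psi *m Y = psi.
  have dlt : delta_mx i j = (delta_mx i 0 : 'M_(3, 1)) *m delta_mx 0 j :> 'M[F]_3.
    by rewrite mul_delta_mx.
  have -> : Y = A *m elem i j 1 *m \adj A *m elem i j (- 1) by [].
  rewrite !mulmxA [X in X *m \adj A](_ : _ = psi *m A); last first.
    rewrite /elem mulmxDr mulmx1 scale1r dlt !mulmxA -[psi *m A *m delta_mx _ _]mulmxA.
    by rewrite psiA mul0mx addr0.
  rewrite -[psi *m A *m _]mulmxA mul_mx_adj dA mulmx1 /elem mulmxDr mulmx1.
  by rewrite -scalemxAr dlt mulmxA psii mul0mx scaler0 addr0.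
have [g dg rg] := last_row_complete psi0.
pose Z := g *m Y *m \adj g.
have dZ : \det Z = 1 by rewrite !det_mul1 ?det_adj.
have NZ : inn Z \in N.
  have -> : inn Z = (inn g * inn Y * (inn g)^-1)%g.
    rewrite /Z -!innM ?det_mul1 ?det_adj //; congr (_ * _)%g.
    by apply/eqP; rewrite eq_sym eq_invg_mul innM ?det_adj // mul_mx_adj dg inn1.
  exact: normal_conj.
have rZ : row 2 Z = row 2 1%:M.
  rewrite /Z row_mul row_mul rg psiY -rg -row_mul mul_mx_adj dg //.
have Z1 : Z != 1%:M.
  apply: contraNneq nAE => Z1.
  have gY : g *m Y = g.
    have := congr1 (mulmx^~ g) Z1; rewrite /Z -mulmxA mul_adj_mx dg mulmx1 mul1mx //.
  have Y1 : Y = 1%:M.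
    have := congr1 (mulmx (\adj g)) gY; rewrite mulmxA mul_adj_mx dg mul1mx //.
  by rewrite YE Y1 mul1mx.
move: Z dZ NZ rZ Z1; elim/mx3_ind=> a b c d e f p q r dZ NZ.
move/rowP=> rZ; have := (rZ 0, rZ 1, rZ 2); rewrite !mxE /= => -[[p0 q0] r1].
rewrite p0 q0 r1 in dZ NZ * => Z1.
exact: (normal_parabolic_all dZ Z1 NZ).
Qed.

Lemma elem_comm_scalar A : (forall i j, i != j -> A *m elem i j 1 = elem i j 1 *m A) ->
  exists k, A = k%:M.
Proof.
elim/mx3_ind: A => a b c d e f g h i cA; exists a.
have := cA 0 1 isT; have := cA 1 2 isT; have := cA 2 0 isT.
rewrite !elemE !mx3_mul !(mulr0, mulr1, mul0r, mul1r, addr0, add0r).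
case/mx3_inj=> -[/eqP + _ _] _ _; rewrite addrC -subr_eq0 addrK => /eqP->.
case/mx3_inj=> -[_ _ /eqP]; rewrite addr0 => /eqP-> [_ /eqP + E] _.
rewrite eq_sym addrC -subr_eq0 addrK => /eqP h0.
move: E; rewrite addrC => /addrI ei.
case/mx3_inj=> -[/eqP + E1 E2] _ [_ E3 _].
rewrite eq_sym addrC -subr_eq0 addrK => /eqP d0.
move: ei E1 E2 E3; rewrite !add0r addr0 => <- <- <- /eqP.
rewrite -subr_eq0 addrK => /eqP->.
by rewrite d0 h0 mx3_scal.
Qed.

(** An outer element out A of N has commutators with the elementary matrices; if
    these are scalar, then A *m itr E is a multiple of E *m A, and comparing entries
    for two matrices E shows that A is singular. *)
Lemma normal_SL_or_scalar :
  contains_elem N \/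
  forall g, g \in N -> exists2 k, \det (k%:M : 'M[F]_3) = 1 & g = inn k%:M.
Proof.
have [allN|nallN] := boolP [forall i, forall j, forall x,
  (i != j) ==> (inn (elem i j x) \in N)].
  by left=> i j x; move/forallP/(_ i)/forallP/(_ j)/forallP/(_ x)/implyP: allN; apply.
right; have {nallN} nallN : ~ contains_elem N.
  move=> allN; case/negP: nallN; apply/forallP=> i; apply/forallP=> j.
  by apply/forallP=> x; apply/implyP; apply: allN.
have inN A : \det A = 1 -> inn A \in N ->
    exists2 k, \det (k%:M : 'M[F]_3) = 1 & A = k%:M.
  move=> dA NA; have [|k Ak] := @elem_comm_scalar A; last by exists k; rewrite -?Ak.
  move=> i j ij; apply/eqP; apply/idPn => nc; apply: nallN.
  exact: normal_noncomm_all nc.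
elim/SL_invtr_ind => A dA NA; first by have [k dk ->] := inN A dA NA; exists k.
have outN i j : i != j -> exists k, A *m itr (elem i j 1) = k *: (elem i j 1 *m A).
  move=> ij; pose E := elem i j 1; have dE : \det E = 1 by rewrite det_elem.
  have dA' := det_adj dA; have dE' := det_adj dE.
  pose Y := A *m itr E *m \adj A *m \adj E.
  have dY : \det Y = 1 by rewrite !det_mul1 ?det_itr.
  have YE : Y *m (E *m A) = A *m itr E.
    rewrite /Y -mulmxA (mulmxA (\adj E)) mul_adj_mx dE mul1mx.
    by rewrite -mulmxA mul_adj_mx dA mulmx1.
  have NY : inn Y \in N.
    have -> : (inn Y = out A * (inn E * (out A)^-1 * (inn E)^-1))%g.
      rewrite !mulgA; apply/(canRL (mulgK _))/(canRL (mulgK _)).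
      by rewrite innM // inn_out ?(det_mul1 dY dE) // out_inn // -mulmxA YE.
    by rewrite groupM // normal_conj ?groupV.
  have [k dk Yk] := inN Y dY NY; exists k.
  by rewrite -/E -YE Yk mul_scalar_mx.
have [k1 +] := outN 0 1 isT; have [k2 +] := outN 2 1 isT.
move: dA {NA outN}; elim/mx3_ind: A => a b c d e f g h i dA.
rewrite !elemE /itr !mx3_adj_tr !mx3_mul -!mul_scalar_mx !mx3_scal !mx3_mul.
rewrite !(mulr0, mulr1, mul0r, mul1r, addr0, add0r, subr0, sub0r, oppr0).
have fix0 (k x : F) : k != 1 -> x = k * x -> x = 0.
  move=> kn1 /eqP; rewrite -{1}[x]mul1r -subr_eq0 -mulrBl mulf_eq0 subr_eq0 eq_sym.
  by rewrite (negPf kn1) => /eqP.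
have det0 (x : F) : x = 1 -> x = 0 -> False.
  by move=> -> /eqP; rewrite oner_eq0.
have subx0 (x y : F) : x + y * -1 = x -> y = 0.
  by rewrite mulrN1 => /eqP; rewrite eq_sym -subr_eq0 opprB addrC subrK => /eqP.
case/mx3_inj=> -[_ _ Ec] [Ed Ee Ef] _ /mx3_inj[_ [Ed' Ee' Ef'] [Eg' _ _]].
exfalso; apply: (det0 _ dA); rewrite mx3_det.
have [k11|k11] := eqVneq k1 1; last first.
  have f0 := fix0 _ _ k11 Ef'; have e0 := fix0 _ _ k11 Ee'.
  have d0 : d = 0 by apply: (fix0 _ _ k11); rewrite -Ed' e0 mul0r addr0.
  by rewrite f0 e0 d0; ring.
rewrite {}k11 !mul1r in Ed' Eg'.
have [k21|k21] := eqVneq k2 1; last first.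
  have e0 := fix0 _ _ k21 Ee; have d0 := fix0 _ _ k21 Ed.
  have f0 : f = 0 by apply: (fix0 _ _ k21); rewrite -Ef e0 mul0r add0r.
  by rewrite f0 e0 d0; ring.
rewrite {}k21 !mul1r addrC in Ec.
rewrite (subx0 _ _ Ed') (subx0 _ _ Eg') (subx0 _ _ Ec); ring.
Qed.

End Normal.
End Elementary.

(** * The generators and the group they generate *)

Section Generators.

Local Open Scope ring_scope.

Variables (F : finFieldType) (w im : F).
Hypotheses (w2 : w ^+ 2 = - w - 1) (w_neq1 : w != 1) (im2 : im ^+ 2 = -1).
Hypotheses (two0 : 2 != 0 :> F) (five0 : 5 != 0 :> F).
(* F is a prime field: one nontrivial element spans a root subgroup. *)
Hypothesis natF : forall x : F, exists n, x = n%:R.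

Definition mx_d : 'M[F]_3 := mx3 (-1) 0 0 0 1 0 0 0 (-1).
(** This is expN 2 *m mx_d.  The factor 2 makes t1 commute with t1 ^ t0, which gives
    the order 4 of t0 * t1. *)
Definition mx_t1 : 'M[F]_3 := mx3 (-1) 2 (-2) 0 1 (-2) 0 0 (-1).
Definition mx_t3 : 'M[F]_3 :=
  mx3 (- w) (- w) 1 (- w) 0 (1 + w) 1 (1 + w) (1 + w).
(** A scalar multiple of expN 1 *m mx_d *m (1 + c e13).  The first factor,
    expN 1 *m mx_d, exchanges t1 and t2, and 1 + c e13 commutes with both, for
    every c.  The value of c and the scalar are chosen to make t0 ^ kappa commute
    with t0. *)
Definition mx_kappa : 'M[F]_3 :=
  mx3 (1 + w) (- 1 - w) w 0 (- 1 - w) (1 + w) 0 0 (1 + w).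
(** The symmetric matrix preserved by the matrices [expN] and [expNT]. *)
Definition mx_form : 'M[F]_3 := mx3 0 0 1 0 (-1) 0 1 0 0.
(** The conjugate of [out mx_form] by kappa is [out mx_form']; as a matrix,
    mx_form' is w^2 times mx_form - (2 w + 1) e11. *)
Definition mx_form' : 'M[F]_3 :=
  mx3 (w - 1) 0 (- 1 - w) 0 (1 + w) 0 (- 1 - w) 0 0.
(** The exponentials of xN and of its transpose, that is, the images of the
    unipotent matrices of SL_2 in the orthogonal group of mx_form. *)
Definition expN x : 'M[F]_3 := mx3 1 x (x ^+ 2 / 2) 0 1 x 0 0 1.
Definition expNT x : 'M[F]_3 := mx3 1 0 0 x 1 0 (x ^+ 2 / 2) x 1.

Lemma w_neq0 : w != 0.
Proof.
apply: contra_eq_neq w2 => ->.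
by rewrite expr0n /= oppr0 sub0r eq_sym oppr_eq0 oner_eq0.
Qed.

Lemma three0 : 3 != 0 :> F.
Proof.
apply: contra_neq w_neq1 => t0; apply/eqP; rewrite -subr_eq0 -sqrf_eq0.
have -> : (w - 1) ^+ 2 = - (3 * w) by ring: w2.
by rewrite t0 mul0r oppr0.
Qed.

Lemma double_w_add1_neq0 : 2 * w + 1 != 0.
Proof.
rewrite -sqrf_eq0; have -> : (2 * w + 1) ^+ 2 = - 3 by ring: w2.
by rewrite oppr_eq0 three0.
Qed.

Ltac det_tac := rewrite mx3_det; try ring: w2.

Lemma det_d : \det mx_d = 1. Proof. by rewrite mx3_det; ring. Qed.
Lemma det_t1 : \det mx_t1 = 1. Proof. by rewrite mx3_det; ring. Qed.
Lemma det_t3 : \det mx_t3 = 1. Proof. det_tac. Qed.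
Lemma det_kappa : \det mx_kappa = 1. Proof. det_tac. Qed.
Lemma det_form : \det mx_form = 1. Proof. by rewrite mx3_det; ring. Qed.
Lemma det_form' : \det mx_form' = 1. Proof. det_tac. Qed.
Lemma det_expN x : \det (expN x) = 1. Proof. by rewrite mx3_det; ring. Qed.
Lemma det_expNT x : \det (expNT x) = 1. Proof. by rewrite mx3_det; ring. Qed.
Lemma det_w2 : \det ((w ^+ 2)%:M : 'M[F]_3) = 1.
Proof. rewrite mx3_scal; det_tac. Qed.

Definition detE := (det_d, det_t1, det_form, det_expN, det_expNT).
Definition detwE := (detE, det_t3, det_kappa, det_form', det_w2).

Definition t0 := out mx_d.
Definition t1 := inn mx_t1.
Definition t2 := inn mx_d.
Definition t3 := out mx_t3.
Definition kappa := inn mx_kappa.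

Ltac word := rewrite ?(innM, inn_out, out_inn, out_out) ?det_mul1 ?det_itr ?detE //.
Ltac wordw := rewrite ?(innM, inn_out, out_inn, out_out) ?det_mul1 ?det_itr ?detwE //.
Ltac matrices := rewrite /itr ?mx3_adj_tr ?mx3_scal ?mx3_mul ?mx3_adj_tr.

Lemma t0K : (t0 * t0 = 1)%g.
Proof. word; rewrite -inn1; congr inn; matrices; congr mx3; ring. Qed.
Lemma t1K : (t1 * t1 = 1)%g.
Proof. word; rewrite -inn1; congr inn; matrices; congr mx3; ring. Qed.
Lemma t2K : (t2 * t2 = 1)%g.
Proof. word; rewrite -inn1; congr inn; matrices; congr mx3; ring. Qed.
Lemma t0_kappa : (t0 * kappa = kappa * t3)%g.
Proof.
by wordw; congr out; rewrite /mx_d /mx_kappa /mx_t3; matrices;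
  congr mx3; ring: w2.
Qed.
Lemma t1_kappa : (t1 * kappa = kappa * t2)%g.
Proof. wordw; congr inn; matrices; congr mx3; ring: w2. Qed.
Lemma t2_kappa : (t2 * kappa = kappa * t1)%g.
Proof. wordw; congr inn; matrices; congr mx3; ring: w2. Qed.
Lemma comm02 : commute t0 t2.
Proof. rewrite /commute; word; congr out; rewrite /mx_d; matrices; congr mx3; ring. Qed.
Lemma comm03 : commute t0 t3.
Proof.
by rewrite /commute; wordw; congr inn; rewrite /mx_d /mx_t3; matrices;
  congr mx3; ring: w2.
Qed.
Lemma t1t2 : (t1 * t2 = inn (expN 2))%g.
Proof. by word; congr inn; rewrite /expN; matrices; congr mx3; field. Qed.

Lemma expND x y : (inn (expN x) * inn (expN y) = inn (expN (x + y)))%g.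
Proof. by word; congr inn; rewrite /expN; matrices; congr mx3; field. Qed.

Lemma expN_nat x n : (inn (expN x) ^+ n = inn (expN (x *+ n)))%g.
Proof.
elim: n => [|n IHn]; last by rewrite expgS IHn expND mulrS.
rewrite expg0 -inn1; congr inn; rewrite /expN mx3_scal mulr0n.
by congr mx3; rewrite expr0n mul0r.
Qed.

Lemma expN_mem (H : {group SL_invtr 3 F}) x :
  t1 \in H -> t2 \in H -> inn (expN x) \in H.
Proof.
move=> H1 H2; have [n nx] := natF (x / 2).
have -> : x = 2 *+ n by rewrite -mulr_natr -nx; field.
by rewrite -expN_nat -t1t2 groupX ?groupM.
Qed.

Lemma expNT_conj x : (inn (expNT x) = t0 * inn (expN x) * t0)%g.
Proof.
by word; congr inn; rewrite /expN /expNT /mx_d; matrices; congr mx3; field.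
Qed.

Lemma expNT_mem (H : {group SL_invtr 3 F}) x :
  t0 \in H -> t1 \in H -> t2 \in H -> inn (expNT x) \in H.
Proof.
move=> H0 H1 H2; rewrite expNT_conj; apply: groupM (groupM H0 _) H0.
exact: expN_mem.
Qed.

(** The image of an antidiagonal matrix of SL_2. *)
Definition weyl x : 'M[F]_3 := mx3 0 0 (x ^+ 2 / 2) 0 (-1) 0 (2 / x ^+ 2) 0 0.

Lemma weylE x : x != 0 -> weyl x = expN x *m expNT (- 2 / x) *m expN x.
Proof.
by move=> x0; rewrite /weyl /expN /expNT; matrices; congr mx3; field; rewrite ?x0 ?two0.
Qed.

Lemma det_weyl x : x != 0 -> \det (weyl x) = 1.
Proof. by move=> x0; rewrite weylE // !det_mul1 ?detE. Qed.

Lemma weyl_mem (H : {group SL_invtr 3 F}) x : x != 0 ->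
  t0 \in H -> t1 \in H -> t2 \in H -> inn (weyl x) \in H.
Proof.
move=> x0 H0 H1 H2; rewrite weylE // -!innM ?det_mul1 ?detE //.
by apply: groupM (groupM _ _) _; [apply: expN_mem | apply: expNT_mem | apply: expN_mem].
Qed.

(** diag(im, 1, -im) *m mx_form.  The diagonal factor acts by -1 on the transvections
    1 + c e13, and this compensates the inversion of these by the polarity:
    common commutes with the transvection that separates the two forms. *)
Definition mx_common : 'M[F]_3 := mx3 0 0 im 0 (-1) 0 (- im) 0 0.
Definition common := out mx_common.

Lemma det_common : \det mx_common = 1. Proof. by rewrite mx3_det; ring: im2. Qed.

Lemma im_neq0 : im != 0.
Proof.
apply: contra_eq_neq im2 => ->.
by rewrite expr0n /= eq_sym oppr_eq0 oner_eq0.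
Qed.

Lemma one_sub_im_neq0 : 1 - im != 0.
Proof.
apply: contra_neq two0 => im1.
have {im1} im1 : im = 1 by rewrite -[LHS]addr0 -im1; ring.
by move/eqP: im2; rewrite im1 expr1n -subr_eq0 opprK => /eqP.
Qed.

(** The corner entry x^2 / 2 of weyl x has to be -im, and -2 im is the square of
    1 - im. *)
Lemma common_weyl : common = (inn (weyl (1 - im)) * t0)%g.
Proof.
rewrite /common /t0 inn_out ?detE ?det_weyl ?one_sub_im_neq0 //; congr out.
rewrite /mx_common /mx_d /weyl; matrices.
have -> : (1 - im) ^+ 2 = - 2 * im by ring: im2.
have -> : 2 / (- 2 * im) = im.
  by field: im2; rewrite ?im_neq0 ?oppr_eq0 ?two0.
by congr mx3; field.
Qed.

(** Up to the unipotent factor, which belongs to <t1, t2>, conjugation by kappa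
    multiplies common by a scalar. *)
Lemma common_kappa :
  (common * kappa = kappa * (inn (w ^+ 2)%:M * common * inn (expN (- 1 - im))))%g.
Proof.
rewrite /common; wordw; rewrite ?det_common //; congr out.
rewrite /mx_common /mx_kappa /expN; matrices.
by congr mx3; field: w2 im2.
Qed.

Lemma elem_add (i j : 'I_3) (x y : F) : i != j ->
  (inn (elem i j x) * inn (elem i j y) = inn (elem i j (x + y)))%g.
Proof.
move=> ij; rewrite innM ?det_elem //; congr inn.
move: ij; elim/ord3_ind: i; elim/ord3_ind: j => // _; rewrite !elemE mx3_mul;
 congr mx3; ring.
Qed.

Lemma elem_multiples (H : {group SL_invtr 3 F}) (i j : 'I_3) a x : i != j ->
  a != 0 -> inn (elem i j a) \in H -> inn (elem i j x) \in H.
Proof.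
move=> ij a0 Ha; have [n nx] := natF (x / a).
have -> : x = a *+ n by rewrite -mulr_natr -nx; field.
elim: n {nx} => [|n IHn].
  by rewrite mulr0n /elem scale0r addr0 inn1 group1.
by rewrite mulrS -elem_add // groupM.
Qed.

Lemma four0 : 4 != 0 :> F.
Proof. by rewrite (_ : 4 = 2 * 2) ?mulf_neq0 //; ring. Qed.

Definition diag4 : 'M[F]_3 := mx3 4 0 0 0 1 0 0 0 (1 / 4).

Lemma diag4E : diag4 = weyl 2 *m weyl 1.
Proof.
rewrite /diag4 /weyl mx3_mul; congr mx3; field; rewrite ?two0 ?four0 ?oner_eq0 //.
Qed.

Lemma det_diag4 : \det diag4 = 1.
Proof. by rewrite diag4E det_mul1 ?det_weyl ?oner_eq0. Qed.

Lemma elem_t0 (i j : 'I_3) : i != j -> exists2 e : F, e ^+ 2 = 1 &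
  forall x, (t0 * inn (elem i j x) * t0 = inn (elem j i (e * x)%R))%g.
Proof.
move=> ij.
have conj x : (t0 * inn (elem i j x) * t0 =
    inn (mx_d *m itr (elem i j x) *m itr mx_d))%g.
  by rewrite out_inn ?out_out ?det_mul1 ?det_itr ?detE ?det_elem.
have [e e1 E] : exists2 e : F, e ^+ 2 = 1 &
    forall x, mx_d *m itr (elem i j x) *m itr mx_d = elem j i (e * x).
  move: ij {conj}; rewrite /mx_d /itr.
  elim/ord3_ind: i; elim/ord3_ind: j => // _;
  first [ by exists 1 => [|x];
             [ring | rewrite !elemE !(mx3_adj_tr, mx3_mul); congr mx3; ring]
        | by exists (-1) => [|x];
             [ring | rewrite !elemE !(mx3_adj_tr, mx3_mul); congr mx3; ring]].
by exists e => [//|x]; rewrite conj E.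
Qed.

Section Subgroup.

Variables H K : {group SL_invtr 3 F}.
Hypotheses (K0 : t0 \in K) (K1 : t1 \in K) (K2 : t2 \in K).
Hypothesis sKH : {subset K <= H}.
Hypothesis Kkappa : forall g, g \in K -> (g ^ kappa)%g \in H.

Let H0 := sKH K0.
Let H1 := sKH K1.
Let H2 := sKH K2.

(** The diagonal matrix diag4 lies in K, and some element g of K is mapped by
    kappa to the conjugate of diag4 by a transvection 1 + c e13.  The quotient of
    these two is a nontrivial transvection, since neither 15 nor 2 w + 1
    is 0 in F. *)
Lemma mem_elem02 x : inn (elem 0 2 x) \in H.
Proof.
(* 15 = 4^2 - 1 comes from the action of diag4 on e13 *)
pose c := 15 * (w + 1 / 2).
have c0 : c != 0.
  have -> : c = 3 * 5 / 2 * (2 * w + 1) by rewrite /c; field.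
  by rewrite !mulf_neq0 ?invr_eq0 ?three0 ?double_w_add1_neq0.
apply: (elem_multiples x (isT : 0 != 2 :> 'I_3) c0).
pose g := (inn (expN 1) * t2 * inn diag4 * t2 * inn (expN (- 1)))%g.
have K4 : inn diag4 \in K.
  rewrite diag4E -innM ?det_weyl ?oner_eq0 //.
  by apply: groupM; apply: weyl_mem; rewrite ?oner_eq0.
have gK : g \in K.
  by apply: groupM (groupM (groupM (groupM _ K2) K4) K2) _; apply: expN_mem.
have cd : inn (elem 0 2 c *m diag4) \in H.
  suff <- : (g ^ kappa = inn (elem 0 2 c *m diag4))%g by apply: Kkappa.
  rewrite conjgE; apply: (mulgI kappa); rewrite mulgA mulgV mul1g.
  rewrite /g ?innM ?det_mul1 ?det_elem ?det_diag4 ?detwE //; congr inn.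
  rewrite elemE /expN /mx_d /diag4 /mx_kappa /c !mx3_mul; congr mx3; field: w2;
    rewrite ?two0 ?four0 ?oner_eq0 //.
by apply: inn_cancelr cd; rewrite ?det_diag4 ?det_elem // sKH.
Qed.

Lemma mem_elem_t0 (i j : 'I_3) : i != j -> (forall x, inn (elem i j x) \in H) ->
  forall x, inn (elem j i x) \in H.
Proof.
move=> ij Hij x; have [e e1 E] := elem_t0 ij.
have -> : x = e * (e * x) by rewrite mulrA -expr2 e1 mul1r.
by rewrite -E; apply: groupM (groupM H0 (Hij _)) H0.
Qed.

(** The transvections elem 0 2 and elem 2 0 generate all of SL_2 on the first and
    last coordinates.  A Weyl element of this SL_2 and [weyl] differ by the
    diagonal matrix delta, which splits expN x into its two simple root
    factors. *)
Lemma contains_elem_gen : contains_elem H.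
Proof.
have H02 := mem_elem02; have H20 := mem_elem_t0 (isT : 0 != 2 :> 'I_3) H02.
have dE (i j : 'I_3) (x : F) : i != j -> \det (elem i j x) = 1 by exact: det_elem.
pose delta : 'M[F]_3 := mx3 1 0 0 0 (-1) 0 0 0 (-1).
have ddelta : \det delta = 1 by rewrite mx3_det; ring.
have Hdelta : inn delta \in H.
  have -> : inn delta = (inn (elem 0 2 2) * inn (elem 2 0 (- 1 / 2)%R)
                         * inn (elem 0 2 2) * inn (weyl 2))%g.
    rewrite ?innM ?det_mul1 ?dE ?det_weyl //; congr inn.
    rewrite !elemE /weyl !mx3_mul; congr mx3; field; rewrite ?two0 ?four0 ?oner_eq0 //.
  have HW : inn (weyl 2) \in H by apply: weyl_mem.
  exact: groupM (groupM (groupM (H02 _) (H20 _)) (H02 _)) HW.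
have H12 x : inn (elem 1 2 x) \in H.
  have E : (inn (expN (x / 2)%R) * inn delta * inn (expN (x / 2)%R) * inn delta
           = inn (elem 0 2 ((x / 2) ^+ 2)%R) * inn (elem 1 2 x)%R)%g.
    rewrite ?innM ?det_mul1 ?dE ?detE //; congr inn.
    rewrite !elemE /expN !mx3_mul; congr mx3; field; rewrite ?two0 ?four0 ?oner_eq0 //.
  rewrite -(groupMl _ (H02 ((x / 2) ^+ 2))) -E.
  have HU := expN_mem (x / 2) H1 H2.
  exact: groupM (groupM (groupM HU Hdelta) HU) Hdelta.
have H01 x : inn (elem 0 1 x) \in H.
  have -> : inn (elem 0 1 x) = (inn (expN x) * inn (elem 1 2 (- x))%R
             * inn (elem 0 2 (x ^+ 2 / 2)%R))%g.
    rewrite ?innM ?det_mul1 ?dE ?detE //; congr inn.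
    by rewrite !elemE /expN !mx3_mul; congr mx3; field.
  exact: groupM (groupM (expN_mem x H1 H2) (H12 _)) (H02 _).
have H21 := mem_elem_t0 (isT : 1 != 2 :> 'I_3) H12.
have H10 := mem_elem_t0 (isT : 0 != 1 :> 'I_3) H01.
by move=> i j x; elim/ord3_ind: i; elim/ord3_ind: j.
Qed.

Lemma generated_mem g : g \in H.
Proof.
have HE := contains_elem_SL contains_elem_gen.
elim/SL_invtr_ind: g => A dA; first exact: HE.
have -> : out A = (inn (A *m mx_d) * t0)%g.
  rewrite inn_out ?det_mul1 ?detE //; congr out; rewrite -mulmxA.
  rewrite [_ *m mx_d](_ : _ = 1%:M) ?mulmx1 // mx3_scal mx3_mul.
  by congr mx3; ring.
by apply: groupM H0; apply: HE; rewrite det_mul1 ?detE.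
Qed.

End Subgroup.

End Generators.

(** * Orders and intersections *)

Section Dihedral.
Local Open Scope group_scope.

Lemma card_gen_involutions (gT : finGroupType) (x y : gT) :
  #[x] = 2 -> #[y] = 2 -> #|<<[set x; y]>>| %| #[x * y] * 2.
Proof.
move=> ox oy; have xx : x * x = 1 by rewrite -expg2 -ox expg_order.
have yy : y * y = 1 by rewrite -expg2 -oy expg_order.
have xV : x^-1 = x by apply/eqP; rewrite eq_invg_mul xx.
have yV : y^-1 = y by apply/eqP; rewrite eq_invg_mul yy.
have nyz : <[y]> \subset 'N(<[x * y]>).
  rewrite cycle_subG inE -cycleJ cycle_subG.
  suff -> : (x * y) ^ y = (x * y)^-1 by rewrite groupV cycle_id.
  by rewrite conjgE invMg xV yV -!mulgA yy mulg1.
have -> : <<[set x; y]>> = <[x * y]> * <[y]>.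
  rewrite -norm_joinEr //; apply/eqP; rewrite eqEsubset gen_subG join_subG !cycle_subG.
  apply/and3P; split.
  - have xyG : x * y \in <[x * y]> <*> <[y]> by rewrite mem_gen // inE cycle_id.
    have yG : y \in <[x * y]> <*> <[y]> by rewrite mem_gen // inE cycle_id orbT.
    apply/subsetP=> z /set2P[->|->] //.
    by rewrite -(groupMr _ yG).
  - by rewrite groupM // mem_gen // !inE eqxx ?orbT.
  - by rewrite mem_gen // !inE eqxx orbT.
by rewrite -[X in _ %| _ * X]oy; apply/dvdnP; exists #|<[x * y]> :&: <[y]>|;
   rewrite /order mul_cardG mulnC.
Qed.

Lemma order4 (gT : finGroupType) (x : gT) : x ^+ 4 = 1 -> x ^+ 2 != 1 -> #[x] = 4.
Proof.
move=> x4 x2; have : #[x] %| 4 by rewrite order_dvdn x4.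
move: x2; rewrite -order_dvdn; have := order_gt0 x.
by case: #[x] => [|[|[|[|[|n]]]]] // _ _ /dvdn_leq; case/(_ isT).
Qed.

Lemma involution_TI (gT : finGroupType) (x y z : gT) : #[x] = 2 -> #[y] = 2 -> x != y ->
  z \in <[x]> -> z \in <[y]> -> z = 1.
Proof.
move=> ox oy xy; rewrite !cycle2g // !inE.
by case/orP=> /eqP->//; rewrite (negPf xy) orbF => /eqP.
Qed.

Lemma dihedral_meet (gT : finGroupType) (x y z : gT) :
  #[x] = 2 -> #[y] = 2 -> #[z] = 2 -> coprime #[x * y] #[y * z] ->
  <<[set x; y]>> :&: <<[set y; z]>> \subset <[y]>.
Proof.
move=> ox oy oz co; set D := _ :&: _.
have yD : <[y]> \subset D by rewrite cycle_subG inE !mem_gen ?inE ?eqxx ?orbT.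
have D2 : #|D| %| 2.
  have -> : 2 = gcdn (#[x * y] * 2) (#[y * z] * 2) by rewrite -muln_gcdl (eqP co).
  rewrite dvdn_gcd (dvdn_trans _ (card_gen_involutions ox oy)) ?cardSg ?subsetIl //.
  by rewrite (dvdn_trans _ (card_gen_involutions oy oz)) ?cardSg ?subsetIr.
have /eqP <- // : <[y]> == D.
by rewrite eqEcard yD -/(#[y]) oy dvdn_leq.
Qed.

End Dihedral.

Lemma uniq4 (T : eqType) (a b c d : T) : a != b -> a != c -> a != d ->
  b != c -> b != d -> c != d -> uniq [:: a; b; c; d].
Proof.
by move=> ab ac ad bc bd cd; rewrite /= !inE !negb_or ab ac ad bc bd cd.
Qed.

Section Rank4.

Local Open Scope ring_scope.

Variables (F : finFieldType) (w : F) (p : nat).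
Hypotheses (w2 : w ^+ 2 = - w - 1) (w_neq1 : w != 1).
Hypotheses (two0 : 2 != 0 :> F) (five0 : 5 != 0 :> F).
Hypothesis natF : forall x : F, exists n, x = n%:R.
Hypotheses (p_prime : prime p) (pF : p%:R = 0 :> F).

Local Notation t0 := (t0 F).
Local Notation t1 := (t1 F).
Local Notation t2 := (t2 F).
Local Notation t3 := (t3 w).
Local Notation kappa := (kappa w).

Definition gens : 4.-tuple (SL_invtr 3 F) := [tuple t0; t1; t2; t3].

Local Notation G J := (Defs.sub_gen gens J).

Lemma ord4_ind (P : 'I_4 -> Prop) : P (inord 0) -> P (inord 1) -> P (inord 2) ->
  P (inord 3) -> forall k, P k.
Proof.
by move=> P0 P1 P2 P3 k; rewrite -(inord_val k); case: k => [[|[|[|[|]]]]].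
Qed.

Lemma tnth_gens k : (k < 4)%N -> tnth gens (inord k) = nth t0 [:: t0; t1; t2; t3] k.
Proof. by move=> k4; rewrite (tnth_nth t0) inordK. Qed.

Lemma t0_kappaJ : (t0 ^ kappa = t3)%g.
Proof. by rewrite conjgE t0_kappa // mulKg. Qed.
Lemma t1_kappaJ : (t1 ^ kappa = t2)%g.
Proof. by rewrite conjgE t1_kappa // mulKg. Qed.
Lemma t2_kappaJ : (t2 ^ kappa = t1)%g.
Proof. by rewrite conjgE t2_kappa // mulKg. Qed.

Lemma inn_neq A B : \det A = 1 -> \det B = 1 -> A != B ->
  inn A != inn B :> SL_invtr 3 F.
Proof. by move=> dA dB; apply: contra_neq; apply: inn_inj. Qed.

Lemma t1_neq1 : t1 != 1%g.
Proof.
rewrite -inn1; apply: inn_neq; rewrite ?detE ?det1 //.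
rewrite mx3_scal; apply: contra_neq two0; rewrite /mx_t1.
by case/mx3_inj=> -[_ ->].
Qed.

Lemma t2_neq1 : t2 != 1%g.
Proof. by rewrite -t1_kappaJ -(conj1g kappa) (inj_eq (conjg_inj _)) t1_neq1. Qed.

Lemma out_neq_inn A B : \det A = 1 -> \det B = 1 -> out A != inn B :> SL_invtr 3 F.
Proof. by move=> dA dB; rewrite eq_sym; apply/eqP/inn_neq_out. Qed.

Lemma t0_neq1 : t0 != 1%g.
Proof. by rewrite -inn1 out_neq_inn ?detE ?det1. Qed.

Lemma order_t0 : #[t0]%g = 2.
Proof. by apply: nt_prime_order; rewrite ?t0_neq1 // expg2 t0K. Qed.
Lemma order_t1 : #[t1]%g = 2.
Proof. by apply: nt_prime_order; rewrite ?t1_neq1 // expg2 t1K. Qed.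
Lemma order_t2 : #[t2]%g = 2.
Proof. by apply: nt_prime_order; rewrite ?t2_neq1 // expg2 t2K. Qed.
Lemma order_t3 : #[t3]%g = 2.
Proof. by rewrite -t0_kappaJ orderJ order_t0. Qed.

Lemma order_t0t1 : #[t0 * t1]%g = 4.
Proof.
have sq : ((t0 * t1) ^+ 2 = inn (mx_d F *m itr (mx_t1 F) *m itr (mx_d F) *m mx_t1 F))%g.
  rewrite expg2 mulgA out_inn ?detE // out_out ?innM ?det_mul1 ?det_itr ?detE //.
apply: order4.
  rewrite (expgM _ 2 2) sq expg2 innM ?det_mul1 ?det_itr ?detE // -inn1.
  congr inn; rewrite /itr /mx_d /mx_t1 !(mx3_adj_tr, mx3_mul) mx3_scal.
  congr mx3; ring.
rewrite sq -inn1; apply: inn_neq; rewrite ?det_mul1 ?det_itr ?detE ?det1 //.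
rewrite /itr /mx_d /mx_t1 !(mx3_adj_tr, mx3_mul) mx3_scal.
apply: contra_neq two0 => /mx3_inj[[_ E _] _ _].
by rewrite -[RHS]oppr0 -E; ring.
Qed.

Lemma order_t1t2 : #[t1 * t2]%g = p.
Proof.
rewrite t1t2 //; apply: nt_prime_order => //.
  rewrite expN_nat // -[2 *+ p]mulr_natr pF mulr0 -inn1; congr inn.
  by rewrite /expN mx3_scal; congr mx3; ring.
rewrite -inn1; apply: inn_neq; rewrite ?detE ?det1 // /expN mx3_scal.
by apply: contra_neq two0 => /mx3_inj[[]].
Qed.

Lemma order_t2t3 : #[t2 * t3]%g = 4.
Proof.
rewrite -t1_kappaJ -t0_kappaJ -conjMg orderJ -orderV invMg.
have -> : (t0^-1 = t0)%g by apply/eqP; rewrite eq_invg_mul t0K.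
have -> : (t1^-1 = t1)%g by apply/eqP; rewrite eq_invg_mul t1K.
exact: order_t0t1.
Qed.

Lemma t12_neq : t1 != t2.
Proof.
apply/eqP=> E; have := order_t1t2; rewrite E t2K order1 => p1.
by move: p_prime; rewrite -p1.
Qed.

Lemma t01_neq : t0 != t1. Proof. by rewrite out_neq_inn ?detE. Qed.

Lemma t23_neq : t2 != t3.
Proof. by rewrite -t1_kappaJ -t0_kappaJ (inj_eq (conjg_inj _)) eq_sym t01_neq. Qed.

Lemma t03_neq : t0 != t3.
Proof.
apply/eqP=> /out_inj; rewrite detE (det_t3 w2) => /(_ erefl erefl).
rewrite /mx_d /mx_t3 => /mx3_inj[[_ /eqP + _] _ _].
by rewrite eq_sym oppr_eq0 (negPf (w_neq0 w2)).
Qed.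

Lemma uniq_gens : uniq gens.
Proof.
have t02 : t0 != t2 by rewrite out_neq_inn ?detE.
have t13 : t1 != t3 by rewrite eq_sym out_neq_inn ?detE ?det_t3.
exact: (uniq4 t01_neq t02 t03_neq t12_neq t13 t23_neq).
Qed.

Lemma order_gens k : #[tnth gens k]%g = 2.
Proof.
elim/ord4_ind: k; rewrite tnth_gens //=;
 [exact: order_t0 | exact: order_t1 | exact: order_t2 | exact: order_t3].
Qed.

Lemma comm13 : commute t1 t3.
Proof.
by rewrite -t2_kappaJ -t0_kappaJ; apply: commute_sym; rewrite /commute -!conjMg comm02.
Qed.

Lemma commute_gens (j k : 'I_4) : (j.+1 < k)%N -> commute (tnth gens j) (tnth gens k).
Proof.
elim/ord4_ind: j; elim/ord4_ind: k; rewrite !inordK // => _; rewrite !tnth_gens //=.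
- exact: comm02.
- exact: comm03.
- exact: comm13.
Qed.

Lemma gens_sub (J : {set 'I_4}) (H : {group SL_invtr 3 F}) :
  (forall k, k \in J -> tnth gens k \in H) -> G J \subset H.
Proof.
by move=> HJ; rewrite gen_subG; apply/subsetP=> _ /imsetP[k kJ ->]; apply: HJ.
Qed.

Lemma mem_gens (a b k : nat) : (a <= k < b)%N -> (k < 4)%N ->
  nth t0 [:: t0; t1; t2; t3] k \in G (itv 4 a b).
Proof.
by move=> kab k4; rewrite -tnth_gens // mem_sub_gen // inE inordK.
Qed.

Lemma mem_gens1 a (z : SL_invtr 3 F) : (a < 4)%N -> z \in G (itv 4 a a.+1) ->
  z \in <[nth t0 [:: t0; t1; t2; t3] a]>%g.
Proof.
move=> a4; apply/subsetP/gens_sub=> k; rewrite inE ltnS -eqn_leq => /eqP ak.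
by rewrite (tnth_nth t0) /= -ak cycle_id.
Qed.

Lemma mem_gens2 a (z : SL_invtr 3 F) : (a < 4)%N -> z \in G (itv 4 a a.+2) ->
  z \in <<[set nth t0 [:: t0; t1; t2; t3] a; nth t0 [:: t0; t1; t2; t3] a.+1]>>%g.
Proof.
move=> a4; apply/subsetP/gens_sub=> k; rewrite inE ltnS => /andP[ak ka].
rewrite (tnth_nth t0) /=; apply: mem_gen.
have /orP[/eqP->|/eqP->] : (k == a :> nat) || (k == a.+1 :> nat).
  by clear -ak ka; lia.
  exact: set21.
exact: set22.
Qed.

Lemma coprime4p : coprime 4 p.
Proof.
rewrite (@coprime_pexpl 2 2 p) // prime_coprime // dvdn_prime2 //.
by apply: contraNneq two0 => p2; rewrite -[X in X == _]/(2%:R) p2 pF.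
Qed.

(** The product of the two polarities: w times a unipotent matrix. *)
Definition mx_ratio : 'M[F]_3 := mx3 w 0 (- w - 2) 0 w 0 0 0 w.

Lemma det_ratio : \det mx_ratio = 1.
Proof. by rewrite mx3_det; ring: w2. Qed.

Lemma form_ratio : (out (mx_form F) * out (mx_form' w) = inn mx_ratio)%g.
Proof.
rewrite out_out ?detwE //; congr inn.
rewrite /mx_form /mx_form' /mx_ratio /itr mx3_adj_tr mx3_mul.
congr mx3; ring: w2.
Qed.

Lemma ratio_corner_neq0 : - w - 2 != 0.
Proof.
apply: contra_neq (three0 w2 w_neq1) => m0.
have -> : 3 = (- w - 2) * (w - 1) by ring: w2.
by rewrite m0 mul0r.
Qed.

Lemma w2_neq_w : w ^+ 2 != w.
Proof.
rewrite expr2 -[X in _ != X]mulr1 (inj_eq (mulfI (w_neq0 w2))) //.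
Qed.

Lemma gens012_commute_form g : g \in G (itv 4 0 3) -> commute g (out (mx_form F)).
Proof.
suff /subsetP sC : G (itv 4 0 3) \subset 'C[out (mx_form F)]%g by move/sC/cent1P.
apply: gens_sub => k; rewrite inE; elim/ord4_ind: k;
  rewrite !inordK ?tnth_gens //= => _;
apply/cent1P; rewrite /commute ?out_out ?out_inn ?inn_out ?detE //;
  [congr inn|congr out|congr out];
rewrite /mx_d /mx_form /mx_t1 /itr !(mx3_mul, mx3_adj_tr); congr mx3; ring.
Qed.

Lemma gens123_commute_form g : g \in G (itv 4 1 4) -> commute g (out (mx_form' w)).
Proof.
suff /subsetP sC : G (itv 4 1 4) \subset 'C[out (mx_form' w)]%g by move/sC/cent1P.
apply: gens_sub => k; rewrite inE; elim/ord4_ind: k;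
  rewrite !inordK ?tnth_gens //= => _;
apply/cent1P; rewrite /commute ?out_out ?out_inn ?inn_out ?detwE //;
  [congr out|congr out|congr inn];
rewrite /mx_d /mx_form' /mx_t1 /mx_t3 /itr !(mx3_mul, mx3_adj_tr); congr mx3; ring: w2.
Qed.

(** Commuting with [mx_ratio] makes an inner element upper triangular with equal
    first and last diagonal entries, and then preserving mx_form leaves expN b or
    expN b *m mx_d.  An outer element would conjugate mx_ratio to its inverse
    transpose, but w^2 differs from w. *)
Lemma gens012_meet_gens123 g :
  g \in G (itv 4 0 3) -> g \in G (itv 4 1 4) -> g \in G (itv 4 1 3).
Proof.
move=> /gens012_commute_form + /gens123_commute_form.
elim/SL_invtr_ind: g => A dA cF cF'.
all: have := commuteM cF cF'; rewrite form_ratio /commute.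
- rewrite !innM ?det_ratio //.
  move/(inn_inj (det_mul1 dA det_ratio) (det_mul1 det_ratio dA)).
  move: cF; rewrite /commute inn_out ?out_inn ?detE //.
  move/out_inj; rewrite !det_mul1 ?det_itr ?detE // => /(_ erefl erefl).
  move: A dA {cF'}; elim/mx3_ind => a b c d e f g h k dA.
  rewrite /mx_form /mx_ratio /itr !(mx3_adj_tr, mx3_mul).
  case/mx3_inj=> -[E1 E2 E3] [E4 E5 E6] [E7 E8 E9].
  case/mx3_inj=> -[P1 P2 P3] [P4 P5 P6] [P7 P8 P9].
  have m0 := ratio_corner_neq0.
  have g0 : g = 0.
    apply: (mulfI m0); transitivity (w * a + 0 * d + (- w - 2) * g - w * a); first ring.
    by rewrite -P1; ring.
  have h0 : h = 0.
    apply: (mulfI m0); transitivity (w * b + 0 * e + (- w - 2) * h - w * b); first ring.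
    by rewrite -P2; ring.
  have k_a : k = a.
    apply: (mulfI m0); transitivity (w * c + 0 * f + (- w - 2) * k - w * c); first ring.
    by rewrite -P3; ring.
  have d0 : d = 0.
    apply: (mulfI m0); transitivity (d * (- w - 2) + e * 0 + f * w - f * w); first ring.
    by rewrite P6; ring.
  rewrite {P1 P2 P3 P4 P5 P6 P7 P8 P9 E4 E6 E7 E8 E9} g0 h0 k_a d0 in dA E1 E2 E3 E5 *.
  have a0 : a != 0.
    apply: contra_eq_neq dA => ->.
    rewrite mx3_det !mul0r eq_sym (_ : _ + _ = 0) ?oner_eq0 //; ring.
  have e1 : e = 1.
    apply: (mulfI a0); transitivity
      (0 * (0 * 0 - e * 0) + 0 * (b * 0 - a * 0) + 1 * (a * e - b * 0));
      first ring.
    by rewrite -E3; ring.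
  have aa : a ^+ 2 = 1.
    transitivity (- (0 * (f * 0 - 0 * a) + -1 * (a * a - c * 0) + 0 * (c * 0 - a * f)));
      first ring.
    by rewrite -E5 e1; ring.
  have bE : b = a * f.
    transitivity (- (0 * (f * 0 - 0 * a) + 0 * (a * a - c * 0) + 1 * (c * 0 - a * f)));
      last ring.
    by rewrite -E2; ring.
  have fE : f = a * b by rewrite bE mulrA -expr2 aa mul1r.
  have cE : c = a * b ^+ 2 / 2.
    apply: (mulfI two0); transitivity (a * 0 + b * 0 + c * 1 + c); first ring.
    by rewrite E1 e1 fE; field.
  have HU : inn (expN b) \in G (itv 4 1 3).
    exact: (expN_mem two0 natF b (@mem_gens 1 3 1 isT isT) (@mem_gens 1 3 2 isT isT)).
  move/eqP: aa; rewrite sqrf_eq1 => /orP[/eqP a1|/eqP a1].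
    rewrite [X in inn X](_ : _ = expN b) // /expN fE cE e1 a1.
    by congr mx3; field.
  have Ht2 : t2 \in G (itv 4 1 3) by apply: (@mem_gens 1 3 2 isT isT).
  have := groupM HU Ht2; rewrite innM ?detE //.
  rewrite [X in _ -> inn X \in _](_ : _ = expN b *m mx_d F) //.
  by rewrite /expN mx3_mul fE cE e1 a1; congr mx3; field.
(* outer case: the middle column of A has to vanish *)
have dP := det_ratio; rewrite (out_inn dA dP) (inn_out dP dA).
move/(out_inj (det_mul1 dA (det_itr dP)) (det_mul1 dP dA)).
move: A dA {cF cF'}; elim/mx3_ind => a b c d e f g h k dA.
rewrite /mx_ratio /itr !(mx3_adj_tr, mx3_mul).
case/mx3_inj=> -[P1 P2 P3] [P4 P5 P6] [P7 P8 P9].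
have n0 : w ^+ 2 - w != 0 by rewrite subr_eq0 w2_neq_w.
have h0 : h = 0.
  apply: (mulfI n0); move/eqP: P8; rewrite -subr_eq0 => /eqP P8.
  by rewrite mulr0 -[RHS]P8; ring.
have e0 : e = 0.
  apply: (mulfI n0); move/eqP: P5; rewrite -subr_eq0 => /eqP P5.
  by rewrite mulr0 -[RHS]P5 h0; ring.
have b0 : b = 0.
  apply: (mulfI n0); move/eqP: P2; rewrite -subr_eq0 => /eqP P2.
  by rewrite mulr0 -[RHS]P2 h0 e0; ring.
exfalso; move/eqP: dA; rewrite mx3_det h0 e0 b0 eq_sym (_ : _ + _ = 0) ?oner_eq0 //.
ring.
Qed.

(** Two dihedral groups of orders 8 and 2p that share an involution meet in the
    group of order 2 generated by it; this settles the intervals of length 2. *)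
Lemma gens_inter a b : (a < b)%N -> (b < 4)%N ->
  G (itv 4 a b) :&: G (itv 4 a.+1 b.+1) \subset G (itv 4 a.+1 b).
Proof.
move=> ab b4; apply/subsetP=> g /setIP[].
have consecutive x y : x != y -> #[x]%g = 2 -> #[y]%g = 2 ->
    g \in <[x]>%g -> g \in <[y]>%g -> g \in G (itv 4 a.+1 b).
  by move=> xy ox oy gx gy; rewrite (involution_TI ox oy xy gx gy) group1.
have meet x y z : #[x]%g = 2 -> #[y]%g = 2 -> #[z]%g = 2 ->
    coprime #[x * y]%g #[y * z]%g -> y \in G (itv 4 a.+1 b) ->
    g \in <<[set x; y]>>%g -> g \in <<[set y; z]>>%g ->
    g \in G (itv 4 a.+1 b).
  move=> ox oy oz co yG gxy gyz.
  have : g \in <[y]>%g by apply: (subsetP (dihedral_meet ox oy oz co)); rewrite inE gxy.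
  by apply/subsetP; rewrite cycle_subG.
case: b ab b4 consecutive meet => [|[|[|[|]]]] //;
  case: a => [|[|[|]]] // _ _ consecutive meet.
- move=> /(@mem_gens1 0 _ isT) g0 /(@mem_gens1 1 _ isT) g1.
  exact: consecutive t01_neq order_t0 order_t1 g0 g1.
- move=> /(@mem_gens2 0 _ isT) g0 /(@mem_gens2 1 _ isT) g1.
  apply: meet order_t0 order_t1 order_t2 _ _ g0 g1.
    by rewrite order_t0t1 order_t1t2 coprime4p.
  exact: (@mem_gens 1 2 1).
- move=> /(@mem_gens1 1 _ isT) g0 /(@mem_gens1 2 _ isT) g1.
  exact: consecutive t12_neq order_t1 order_t2 g0 g1.
- exact: gens012_meet_gens123.
- move=> /(@mem_gens2 1 _ isT) g0 /(@mem_gens2 2 _ isT) g1.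
  apply: meet order_t1 order_t2 order_t3 _ _ g0 g1.
    by rewrite order_t2t3 order_t1t2 coprime_sym coprime4p.
  exact: (@mem_gens 2 3 2).
- move=> /(@mem_gens1 2 _ isT) g0 /(@mem_gens1 3 _ isT) g1.
  exact: consecutive t23_neq order_t2 order_t3 g0 g1.
Qed.

Lemma gens012_kappa g : g \in G (itv 4 0 3) -> (g ^ kappa)%g \in G (itv 4 1 4).
Proof.
rewrite -mem_conjgV; apply/subsetP.
apply: (@gens_sub _ (G (itv 4 1 4) :^ kappa^-1)%G)=> k; rewrite inE mem_conjgV.
elim/ord4_ind: k; rewrite !inordK ?tnth_gens //= => _.
- rewrite t0_kappaJ; exact: (@mem_gens 1 4 3).
- rewrite t1_kappaJ; exact: (@mem_gens 1 4 2).
- rewrite t2_kappaJ; exact: (@mem_gens 1 4 1).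
Qed.

Lemma gens_generate : G setT = [set: SL_invtr 3 F].
Proof.
apply/eqP; rewrite eqEsubset subsetT /=; apply/subsetP=> g _.
have sT J : {subset G J <= G setT} by apply/subsetP/sub_genS/subsetT.
apply: (generated_mem w2 w_neq1 two0 five0 natF
          (K := sub_gen_Group gens (itv 4 0 3))).
- exact: (@mem_gens 0 3 0).
- exact: (@mem_gens 0 3 1).
- exact: (@mem_gens 0 3 2).
- exact: sT.
- by move=> h /gens012_kappa; apply: sT.
Qed.

Lemma gens_cstring : cstring [set: SL_invtr 3 F] gens.
Proof.
split; first by split; [exact: uniq_gens | exact: order_gens].
- exact: gens_generate.
- exact: commute_gens.
- apply: intersection_property; [exact: commute_gens | exact: gens_inter].
Qed.

Lemma gens_schlafli : schlafli gens = [:: 4; p; 4]%N.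
Proof. by rewrite /= order_t0t1 order_t1t2 order_t2t3. Qed.

End Rank4.

(** * The quotient by the scalars *)

Section Quotient.
Local Open Scope group_scope.

Lemma sub_gen_tquo (gT : finGroupType) n (t : n.-tuple gT) (N : {group gT}) J :
  N <| [set: gT] -> Defs.sub_gen (tquo t N) J = Defs.sub_gen t J / N.
Proof.
move=> nN; have sN (A : {set gT}) : A \subset 'N(N).
  exact: subset_trans (subsetT A) (normal_norm nN).
rewrite /Defs.sub_gen [RHS]morphim_gen // morphimEsub // -imset_comp.
by congr <<_>>; apply: eq_imset => j /=; rewrite tnth_map.
Qed.

End Quotient.

Section UnravelledGens.

Local Open Scope ring_scope.

Variables (F : finFieldType) (w im : F).
Hypotheses (w2 : w ^+ 2 = - w - 1) (im2 : im ^+ 2 = -1).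
Hypothesis two0 : 2 != 0 :> F.
Hypothesis natF : forall x : F, exists n, x = n%:R.

Local Notation gens := (gens w).
Local Notation G J := (Defs.sub_gen gens J).
Local Notation common := (common im).

Lemma common_in_gens012 : common \in G (itv 4 0 3).
Proof.
rewrite common_weyl //.
have K0 := @mem_gens F w 0 3 0 isT isT.
have K1 := @mem_gens F w 0 3 1 isT isT.
have K2 := @mem_gens F w 0 3 2 isT isT.
exact: groupM (weyl_mem two0 natF (one_sub_im_neq0 im2 two0) K0 K1 K2) K0.
Qed.

Lemma scalar_common_in_gens123 : (inn (w ^+ 2)%:M * common)%g \in G (itv 4 1 4).
Proof.
have := gens012_kappa w2 common_in_gens012.
rewrite conjgE (common_kappa w2 im2 two0) mulKg.
rewrite groupMr //; apply: expN_mem => //.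
  exact: (@mem_gens F w 1 4 1 isT isT).
exact: (@mem_gens F w 1 4 2 isT isT).
Qed.

Lemma gens12_Inn : G (itv 4 1 3) \subset Inn F.
Proof.
apply: gens_sub => k; rewrite inE; elim/ord4_ind: k;
  rewrite !inordK ?tnth_gens //= => _;
by rewrite inn_Inn ?detE.
Qed.

Lemma scalar_group_contains_w2 (N : {group SL_invtr 3 F}) : N :!=: 1%g ->
  (forall g, g \in N -> exists2 k, \det (k%:M : 'M[F]_3) = 1 & g = inn k%:M) ->
  inn (w ^+ 2)%:M \in N.
Proof.
move=> /trivgPn[g gN g1] Nscal; have [k dk gk] := Nscal g gN.
have k1 : k != 1 by apply: contraNneq g1 => k1; rewrite gk k1 inn1.
have k3 : (k - 1) * ((k - w) * (k - w ^+ 2)) = 0.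
  have <- : k ^+ 3 - 1 = 0 by rewrite -[X in _ - X]dk mx3_scal mx3_det; ring.
  by ring: w2.
move/eqP: k3; rewrite mulf_eq0 subr_eq0 (negPf k1) /= mulf_eq0 !subr_eq0.
case/orP=> /eqP kw; last by rewrite -kw -gk.
have -> : inn (w ^+ 2)%:M = (g * g)%g :> SL_invtr 3 F.
  by rewrite gk innM // -scalar_mxM kw expr2.
exact: groupM.
Qed.

(** If N contains SL_3, then t1 and t2 have the same image.  Otherwise N consists of
    scalars and contains w^2, so that common lies in the image of <t0, t1, t2> and
    in that of <t1, t2, t3>, but not in the image of the inner group <t1, t2>. *)
Lemma gens_unravelled : unravelled [set: SL_invtr 3 F]%G gens.
Proof.
move=> N nN N1 _; have le4 : (#|[set x in tquo gens N]| <= 4)%N.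
  by rewrite cardsE (leq_trans (card_size _)) // size_tuple.
have nNx x : x \in ('N(N))%g by apply: (subsetP (normal_norm nN)); rewrite inE.
have [Nall|Nscal] := normal_SL_or_scalar nN.
  left; rewrite ltn_neqAle le4 andbT cardsE; apply/eqP=> E.
  have : uniq (tquo gens N) by apply/card_uniqP; rewrite size_tuple.
  have NA A : \det A = 1 -> coset N (inn A) = 1%g.
    by move=> dA; apply: coset_id; apply: contains_elem_SL.
  rewrite /= /t1 /t2 !NA ?detE // => /and3P[_].
  by rewrite mem_head.
have zN := scalar_group_contains_w2 N1 Nscal.
move: le4; rewrite leq_eqVlt => /orP[/eqP c4|]; last by left.
right; split=> // -[_ _ _ /(_ (itv 4 0 3) (itv 4 1 4))].
have -> : itv 4 0 3 :&: itv 4 1 4 = itv 4 1 3.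
  by apply/setP=> k; rewrite !inE; have := ltn_ord k; clear; lia.
rewrite !sub_gen_tquo // => /setP/(_ (coset N common)).
rewrite inE mem_quotient ?common_in_gens012 //.
have zy : coset N (inn (w ^+ 2)%:M * common)%g = coset N common.
  by rewrite morphM ?nNx //= (coset_id zN) mul1g.
rewrite -{1}zy mem_quotient ?scalar_common_in_gens123 //= => /esym/morphimP[z _ zG].
move/(rcoset_kercosetP (nNx _) (nNx _)) => /rcosetP[n /Nscal[k dk ->] yE].
have : common \in Inn F by rewrite yE groupM ?inn_Inn // (subsetP gens12_Inn).
by rewrite (negPf (out_notin_Inn (det_common im2))).
Qed.

End UnravelledGens.

(** * Roots of unity and the theorem *)

Section Roots.
Local Open Scope ring_scope.

Lemma finField_prim_root (F : finFieldType) n : (n %| #|F|.-1)%N ->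
  exists x : F, x ^+ n = 1 /\ forall m, x ^+ m = 1 -> (n %| m)%N.
Proof.
move=> nF; have /cyclicP[g gE] := field_unit_group_cyclic [set: {unit F}]%G.
have og : #[g]%g = #|F|.-1 by rewrite -card_finField_unit gE.
have ox : #[g ^+ (#|F|.-1 %/ n)]%g = n.
  by rewrite orderXdiv og ?dvdn_div // divnA // mulKn // -og order_gt0.
exists (val (g ^+ (#|F|.-1 %/ n))%g); split=> [|m].
  by rewrite -FinRing.val_unitX -{2}ox expg_order.
rewrite -FinRing.val_unitX -{1}(FinRing.val_unit1 F) => /val_inj/eqP.
by rewrite -order_dvdn ox.
Qed.

End Roots.

Theorem theorem1p3 (p : nat) (p_prime : prime p)
    (p_mod3 : p = 1 %[mod 3]) (p_mod8 : p = 5 %[mod 8]) :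
  exists t : 4.-tuple (SL_invtr 3 'F_p),
    [/\ cstring [set: SL_invtr 3 'F_p] t,
        unravelled [set: SL_invtr 3 'F_p]%G t
      & schlafli t = [:: 4; p; 4]].
Proof.
have natE k : ((k%:R : 'F_p) == 0)%R = (p %| k).
  by rewrite (dvdn_pcharf (pchar_Fp p_prime)).
have two0 : (2 != 0 :> 'F_p)%R.
  rewrite natE dvdn_prime2 //; apply/eqP=> p2; move: p_mod3; rewrite p2 //.
have five0 : (5 != 0 :> 'F_p)%R.
  rewrite natE dvdn_prime2 //; apply/eqP=> p5; move: p_mod3; rewrite p5 //.
have pF : (p%:R = 0 :> 'F_p)%R by apply/eqP; rewrite natE.
have natF (x : 'F_p) : exists n, (x = n%:R)%R by exists x; rewrite natr_Zp.
have p_gt1 := prime_gt1 p_prime.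
have [|im [im4 im_ord]] := @finField_prim_root 'F_p 4.
  by rewrite card_Fp //; lia.
have [|w [w3 w_ord]] := @finField_prim_root 'F_p 3.
  by rewrite card_Fp //; lia.
have im2 : (im ^+ 2 = -1)%R.
  have : ((im ^+ 2) ^+ 2 == 1)%R by rewrite -exprM im4.
  by rewrite sqrf_eq1 => /orP[/eqP/im_ord //|/eqP].
have w_neq1 : (w != 1)%R by apply/eqP=> w1; have := w_ord 1 w1.
have w2 : (w ^+ 2 = - w - 1)%R.
  have w3' : ((w - 1) * (w ^+ 2 - (- w - 1)) = 0)%R.
    by transitivity (w ^+ 3 - 1)%R; [ring | rewrite w3 subrr].
  move/eqP: w3'; rewrite mulf_eq0 !subr_eq0 (negPf w_neq1) => /eqP//.
exists (gens w); split.
- exact: (gens_cstring w2 w_neq1 two0 five0 natF p_prime pF).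
- by apply: gens_unravelled; eassumption.
- by apply: gens_schlafli.
Qed.
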